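(* Let $\mathcal{X}$ be a compact metric space, $k_X$ a universal kernel on $\mathcal{X}$, $k'_X$ a continuous universal kernel on $\mathcal{X}$, and $\mathfrak{K}$ a kernel on the RKHS $\mathcal{H}_{k'_X}$ that is universal on every compact subset of $\mathcal{H}_{k'_X}$. Let $\Psi(P)=\int_{\mathcal{X}}k'_X(x,\cdot)\,dP(x)$ for $P\in\mathfrak{P}_{\mathcal{X}}$, $k_P(P,P')=\mathfrak{K}(\Psi(P),\Psi(P'))$, and $\bar k((P_1,x_1),(P_2,x_2))=k_P(P_1,P_2)k_X(x_1,x_2)$. Then $\bar k$ is universal on $\mathfrak{P}_{\mathcal{X}}\times\mathcal{X}$. Furthermore, the assumption on $\mathfrak{K}$ is fulfilled if $\mathfrak{K}(v,v')=G(\langle v,v'\rangle)$ where $G$ is an analytic function with positive Taylor series coefficients, or if $\mathfrak{K}$ is the normalized kernel $\mathfrak{K}^*(v,v')=\mathfrak{K}_0(v,v')/\sqrt{\mathfrak{K}_0(v,v)\mathfrak{K}_0(v',v')}$ associated to such a kernel $\mathfrak{K}_0$.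
   Context: $\mathfrak{P}_{\mathcal{X}}$ is the set of Borel probability distributions on $\mathcal{X}$, endowed with the topology of weak convergence (a compact metric space, e.g. via the Prohorov metric). A kernel on a compact metric space $\Omega$ is universal if its RKHS is dense in $C(\Omega)$ for the supremum norm; ''universal on a compact subset $C$'' means the restriction to $C$ is universal on $C$. *)

(* Defs.v *)
From HB Require Import structures.
From mathcomp Require Import all_boot all_order all_algebra.
From mathcomp Require Import all_classical all_reals all_analysis.
Set Implicit Arguments. Unset Strict Implicit. Unset Printing Implicit Defensive.
Import Order.TTheory GRing.Theory Num.Theory.
Import numFieldNormedType.Exports.
Local Open Scope classical_set_scope.
Local Open Scope ring_scope.

Section Defs.
Variable R : realType.

Section Kernels.
Variable T : Type.

(* a finite linear combination  sum_i c_i k(x_i, .)  is represented by the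
   sequence of pairs (x_i, c_i) *)
Definition pre_eval (k : T -> T -> R) (s : seq (T * R)) (t : T) : R :=
  \sum_(p <- s) p.2 * k p.1 t.

Definition pre_inner (k : T -> T -> R) (s s' : seq (T * R)) : R :=
  \sum_(p <- s) \sum_(q <- s') p.2 * q.2 * k p.1 q.1.

Definition pre_sub (s s' : seq (T * R)) : seq (T * R) :=
  s ++ [seq (p.1, - p.2) | p <- s'].

Definition pts_in (D : set T) (s : seq (T * R)) : Prop :=
  foldr (fun p P => D p.1 /\ P) True s.

Definition is_kernel (D : set T) (k : T -> T -> R) : Prop :=
  (forall x y, D x -> D y -> k x y = k y x) /\
  (forall s, pts_in D s -> 0 <= pre_inner k s s).

Definition rkhs_rep (D : set T) (k : T -> T -> R) (u : nat -> seq (T * R))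
    (f : T -> R) : Prop :=
  (forall n, pts_in D (u n)) /\
  (forall e, 0 < e -> exists N, forall n m, (N <= n)%N -> (N <= m)%N ->
      pre_inner k (pre_sub (u n) (u m)) (pre_sub (u n) (u m)) < e) /\
  (forall t, D t -> pre_eval k (u n) t @[n --> \oo] --> f t).

Definition rkhs (D : set T) (k : T -> T -> R) : set (T -> R) :=
  [set f | exists u, rkhs_rep D k u f].

Definition rkhs_inner (D : set T) (k : T -> T -> R) (f g : T -> R) : R :=
  xget 0 [set r | exists u v, rkhs_rep D k u f /\ rkhs_rep D k v g /\
                    pre_inner k (u n) (v n) @[n --> \oo] --> r].

Definition rkhs_dist (D : set T) (k : T -> T -> R) (f g : T -> R) : R :=
  Num.sqrt (rkhs_inner D k (fun t => f t - g t) (fun t => f t - g t)).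

Definition universal_wrt (cont : (T -> R) -> Prop) (D : set T)
    (k : T -> T -> R) : Prop :=
  is_kernel D k /\
  (forall f, rkhs D k f -> cont f) /\
  (forall g, cont g -> forall e, 0 < e ->
     exists2 h, rkhs D k h & forall t, D t -> `|g t - h t| < e).

Definition d_compact (d : T -> T -> R) (C : set T) : Prop :=
  forall G : set (set T),
    (forall U, G U -> forall x, C x -> U x ->
        exists2 e, 0 < e & forall y, C y -> d x y < e -> U y) ->
    C `<=` \bigcup_(U in G) U ->
    exists2 F, F `<=` G & finite_set F /\ C `<=` \bigcup_(U in F) U.

Definition d_cont_on (d : T -> T -> R) (C : set T) (g : T -> R) : Prop :=
  forall x, C x -> forall e, 0 < e ->
    exists2 delta, 0 < delta &
      forall y, C y -> d x y < delta -> `|g x - g y| < e.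

End Kernels.

Section Prob.
Variable X : pseudoPMetricType R.

Definition borel_of := g_sigma_algebraType (@open X).

Definition probs := probability (borel_of) R.

Definition integ (P : probs) (f : X -> R) : R :=
  fine (\int[P]_(z in setT) (f z)%:E).

(* continuity of g : P_X * X -> R for the product of the weak topology on P_X
   (initial topology of P |-> int f dP, f in C_b(X)) and the metric topology
   of X, expressed through basic neighbourhoods *)
Definition weak_prod_cont (g : probs * X -> R) : Prop :=
  forall P x e, 0 < e ->
    exists n (f : 'I_n -> X -> R), exists2 delta, 0 < delta &
      (forall i, continuous (f i) /\ exists M, forall z, `|f i z| <= M) /\
      forall Q y, (forall i, `|integ Q (f i) - integ P (f i)| < delta) ->
        ball x delta y -> `|g (Q, y) - g (P, x)| < e.

Definition kme (k' : X -> X -> R) (P : probs) : X -> R :=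
  fun t => integ P (fun x => k' x t).

Definition K_assumption (k' : X -> X -> R) (K : (X -> R) -> (X -> R) -> R) :=
  is_kernel (rkhs setT k') K /\
  forall C, C `<=` rkhs setT k' -> d_compact (rkhs_dist setT k') C ->
    universal_wrt (d_cont_on (rkhs_dist setT k') C) C K.

End Prob.
End Defs.

(* Main.v *)
(* A function f belongs to the RKHS of k iff M k - f (x) f is positive semidefinite
   for some M. With Schur's product theorem this criterion gives every membership
   needed: mean embeddings, products g(P) h(x), and the monomials
   <w_1, .> ... <w_n, .>, which are dominated by the n-th Taylor term of
   G(<., .>). Hence Taylor kernels are universal on compact sets by
   Stone-Weierstrass, and normalizing only multiplies the RKHS by the positive
   continuous function v |-> K(v, v)^(-1/2).

   For the product kernel, Psi is a homeomorphism from the weak topology onto its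
   image: the sections of k' are equicontinuous, so weakly close measures have
   close embeddings, and the converse is the density of the RKHS of k'. Weak
   compactness of the set of probability measures comes from the Riesz-Markov
   theorem, applied to limits of integrals along ultrafilters. The functions
   g(P) h(x) with g, h continuous then span a dense set by Stone-Weierstrass, and
   each factor is approximated in the RKHS of K or of k_X. Conversely, elements of
   the RKHS of the product kernel are uniform limits of continuous functions
   because both kernels are bounded on the diagonal. For k_X, which is not assumed
   jointly continuous, this is a uniform boundedness (gliding hump) argument. *)
Require Import Defs.
From HB Require Import structures.
From mathcomp Require Import all_boot all_order all_algebra.
From mathcomp Require Import all_classical all_reals all_analysis.
From mathcomp Require Import finmap measurable_realfun ring lra.
Import Order.TTheory GRing.Theory Num.Theory.
Import numFieldNormedType.Exports.
Set Implicit Arguments.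
Unset Strict Implicit.
Unset Printing Implicit Defensive.
Local Open Scope classical_set_scope.
Local Open Scope ring_scope.

(** * Kernels and their reproducing kernel Hilbert spaces *)

(** The RKHS is never built as a completed space: an element is a plain function that is the
    pointwise limit of some Cauchy sequence of finite combinations, and it is handled through the
    functional [ev f] on such combinations. Consequently [rkhs_inner] is only a chosen limit, and
    its independence of the sequences must be proved before any geometry is available. Once it is
    known to be a kernel on the RKHS, the lemmas on kernels apply to it verbatim. A second obstacle
    is that neither subsets of the RKHS under [rkhs_dist] nor measures under the weak topology come
    as topological spaces. Continuity is therefore read as convergence along explicit neighbourhood
    filters ([dnbhs], [wnbhs]), and compactness as extraction of finite subcovers, obtained for
    measures by following ultrafilters. *)

Section RealFacts.
Context (R : realType).

Lemma cvg_seqP (u : nat -> R) (l : R) :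
  u n @[n --> \oo] --> l <->
  forall e : R, 0 < e -> exists N, forall n, (N <= n)%N -> `|l - u n| < e.
Proof.
split=> [/cvgrPdist_lt ul e e0|ul].
  by have [N _ uN] := ul e e0; exists N => n Nn; apply: uN.
apply/cvgrPdist_lt => e e0; have [N uN] := ul e e0.
by exists N => // n /= Nn; apply: uN.
Qed.

Lemma cvg_seq_le (u : nat -> R) (l M : R) (N : nat) :
  u n @[n --> \oo] --> l -> (forall n, (N <= n)%N -> u n <= M) -> l <= M.
Proof.
move=> /cvg_seqP ul uM; rewrite leNgt; apply/negP => Ml.
have [|N' /(_ (maxn N N')) uN] := ul (l - M); first by rewrite subr_gt0.
have := uN (leq_maxr _ _); have := uM _ (leq_maxl N N') => h1.
by rewrite ltr_norml => /andP[_]; lra.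
Qed.

Lemma cvg_seq_unique (u : nat -> R) (l l' : R) :
  u n @[n --> \oo] --> l -> u n @[n --> \oo] --> l' -> l = l'.
Proof. by move=> ul ul'; rewrite -(cvg_lim _ ul)// -(cvg_lim _ ul'). Qed.

Lemma norm_le_sq (x e : R) : 0 <= e -> x ^+ 2 <= e ^+ 2 -> `|x| <= e.
Proof. by move=> e0; rewrite -[x ^+ 2]real_normK ?num_real// ler_sqr ?nnegrE. Qed.

Lemma norm_lt_sq (x e : R) : 0 <= e -> x ^+ 2 < e ^+ 2 -> `|x| < e.
Proof. by move=> e0; rewrite -[x ^+ 2]real_normK ?num_real// ltr_sqr ?nnegrE. Qed.

Lemma quad_disc (a b d : R) : 0 <= d ->
  (forall c, 0 <= a + 2 * b * c + d * c ^+ 2) -> b ^+ 2 <= a * d.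
Proof.
rewrite le_eqVlt => /predU1P[<-|d0] H.
  have [->|b0] := eqVneq b 0; first by rewrite expr0n mulr0.
  (* For d = 0 the function of c is affine and takes the value -1 here; for d > 0 the minimiser - b
     / d is used. *)
  have := H (- (a + 1) / (2 * b)).
  rewrite (_ : _ + _ = - 1); last by field.
  lra.
have := H (- b / d).
rewrite (_ : _ + _ = (a * d - b ^+ 2) / d); last by field; rewrite gt_eqF.
by rewrite pmulr_lge0 ?invr_gt0// subr_ge0.
Qed.

End RealFacts.

(** * Finite combinations, Cauchy-Schwarz and Schur's product theorem *)

Section Combinations.
Context (R : realType) (T : Type).
Implicit Types (f g : T -> R) (s t : seq (T * R)) (k : T -> T -> R) (D : set T).

(** The combination read as a finite signed measure and applied to [f]; for [f] in the RKHS it is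
    the inner product of [f] with the combination. *)
Definition ev f s : R := \sum_(p <- s) p.2 * f p.1.
Definition scale (c : R) s : seq (T * R) := [seq (p.1, c * p.2) | p <- s].
Definition weight f s : seq (T * R) := [seq (p.1, p.2 * f p.1) | p <- s].
Definition psd D k := forall s, pts_in D s -> 0 <= pre_inner k s s.

Lemma ev_nil f : ev f [::] = 0.
Proof. by rewrite /ev big_nil. Qed.

Lemma ev_cons f p s : ev f (p :: s) = p.2 * f p.1 + ev f s.
Proof. by rewrite /ev big_cons. Qed.

Lemma ev_cat f s t : ev f (s ++ t) = ev f s + ev f t.
Proof. by rewrite /ev big_cat. Qed.

Lemma ev_scale f c s : ev f (scale c s) = c * ev f s.
Proof. by rewrite /ev big_map mulr_sumr; apply: eq_bigr => p _; rewrite mulrA. Qed.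

Lemma ev0 s : ev (fun=> 0) s = 0.
Proof. by rewrite /ev big1// => p _; rewrite mulr0. Qed.

Lemma evD f g s : ev (fun x => f x + g x) s = ev f s + ev g s.
Proof. by rewrite /ev -big_split; apply: eq_bigr => p _; rewrite mulrDr. Qed.

Lemma evZ c f s : ev (fun x => c * f x) s = c * ev f s.
Proof. by rewrite /ev mulr_sumr; apply: eq_bigr => p _; rewrite mulrCA. Qed.

Lemma pts_in_cat D s t : pts_in D (s ++ t) <-> pts_in D s /\ pts_in D t.
Proof.
elim: s => [|p s IH] /=; first by split => // -[].
by split=> [[? /IH[? ?]]|[[? ?] ?]]; split => //; apply/IH.
Qed.

Lemma pts_in_scale D c s : pts_in D (scale c s) <-> pts_in D s.
Proof. by elim: s => [|p s IH] //=; split=> -[? /IH]. Qed.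

Lemma pts_in_weight D f s : pts_in D (weight f s) <-> pts_in D s.
Proof. by elim: s => [|p s IH] //=; split=> -[? /IH]. Qed.

Lemma pts_inS D D' s : D `<=` D' -> pts_in D s -> pts_in D' s.
Proof. by move=> DD'; elim: s => [|p s IH] //= [/DD' ? /IH]. Qed.

Lemma pts_inT s : pts_in setT s.
Proof. by elim: s. Qed.

Lemma eq_ev D f g s : (forall x, D x -> f x = g x) -> pts_in D s -> ev f s = ev g s.
Proof.
move=> fg; elim: s => [|p s IH] /=; first by rewrite !ev_nil.
by move=> [Dp Ds]; rewrite !ev_cons fg// IH.
Qed.

Lemma pre_subE s t : pre_sub s t = s ++ scale (-1) t.
Proof. by congr (_ ++ _); apply: eq_map => p; rewrite mulN1r. Qed.

Lemma pre_evalE k s x : pre_eval k s x = ev (k^~ x) s.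
Proof. by []. Qed.

Lemma pre_innerE k s t : pre_inner k s t = ev (fun x => ev (k x) t) s.
Proof.
apply: eq_bigr => p _; rewrite /ev mulr_sumr.
by apply: eq_bigr => q _; rewrite mulrA.
Qed.

Lemma pre_inner_catl k s s' t :
  pre_inner k (s ++ s') t = pre_inner k s t + pre_inner k s' t.
Proof. by rewrite !pre_innerE ev_cat. Qed.

Lemma pre_inner_catr k s t t' :
  pre_inner k s (t ++ t') = pre_inner k s t + pre_inner k s t'.
Proof. by rewrite !pre_innerE -evD; congr ev; apply/funext => x; rewrite ev_cat. Qed.

Lemma pre_inner_scalel k c s t : pre_inner k (scale c s) t = c * pre_inner k s t.
Proof. by rewrite !pre_innerE ev_scale. Qed.

Lemma pre_inner_scaler k c s t : pre_inner k s (scale c t) = c * pre_inner k s t.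
Proof. by rewrite !pre_innerE -evZ; congr ev; apply/funext => x; rewrite ev_scale. Qed.

Lemma pre_inner1r k s x c : pre_inner k s [:: (x, c)] = c * pre_eval k s x.
Proof.
rewrite pre_innerE pre_evalE -evZ.
by congr ev; apply/funext => y; rewrite ev_cons ev_nil addr0.
Qed.

Lemma pre_inner1l k t x c : pre_inner k [:: (x, c)] t = c * ev (k x) t.
Proof. by rewrite pre_innerE ev_cons ev_nil addr0. Qed.

Lemma pre_inner_ev k s t : pre_inner k s t = ev (pre_eval k s) t.
Proof.
elim: t => [|[x c] t IH].
  rewrite ev_nil pre_innerE (_ : (fun x => _) = (fun=> 0 * 0)); last first.
    by apply/funext => x; rewrite ev_nil mulr0.
  by rewrite evZ mul0r.
by rewrite -cat1s pre_inner_catr ev_cat IH pre_inner1r ev_cons ev_nil addr0.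
Qed.

Lemma pre_innerC D k s t : (forall x y, D x -> D y -> k x y = k y x) ->
  pts_in D s -> pts_in D t -> pre_inner k s t = pre_inner k t s.
Proof.
move=> ksym Ds Dt; rewrite pre_innerE pre_inner_ev.
apply: (@eq_ev D) => // x Dx; rewrite pre_evalE.
apply: (@eq_ev D) => // y Dy; exact: ksym.
Qed.

Lemma eq_pre_inner D k k' s t : (forall x y, D x -> D y -> k x y = k' x y) ->
  pts_in D s -> pts_in D t -> pre_inner k s t = pre_inner k' s t.
Proof.
move=> kk' Ds Dt; rewrite !pre_innerE.
apply: (@eq_ev D) => // x Dx; apply: (@eq_ev D) => // y Dy; exact: kk'.
Qed.

Lemma pre_innerD k k' s t : pre_inner (fun x y => k x y + k' x y) s t =
  pre_inner k s t + pre_inner k' s t.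
Proof. by rewrite !pre_innerE -evD; congr ev; apply/funext => x; rewrite evD. Qed.

Lemma pre_innerZ c k s t : pre_inner (fun x y => c * k x y) s t = c * pre_inner k s t.
Proof. by rewrite !pre_innerE -evZ; congr ev; apply/funext => x; rewrite evZ. Qed.

Lemma pre_inner_rank1 f g s t : pre_inner (fun x y => f x * g y) s t = ev f s * ev g t.
Proof.
rewrite pre_innerE mulrC -evZ; congr ev; apply/funext => x.
by rewrite evZ mulrC.
Qed.

Lemma pre_inner_weight k f s :
  pre_inner (fun x y => k x y * (f x * f y)) s s = pre_inner k (weight f s) (weight f s).
Proof.
rewrite /pre_inner big_map; apply: eq_bigr => p _.
by rewrite big_map; apply: eq_bigr => q _ /=; ring.
Qed.

Lemma pre_inner_sq D k s t c : is_kernel D k -> pts_in D s -> pts_in D t ->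
  pre_inner k (s ++ scale c t) (s ++ scale c t) =
  pre_inner k s s + 2 * pre_inner k s t * c + pre_inner k t t * c ^+ 2.
Proof.
move=> [ksym _] Ds Dt; rewrite pre_inner_catl !pre_inner_catr.
rewrite !pre_inner_scalel !pre_inner_scaler (pre_innerC ksym Dt Ds); ring.
Qed.

Lemma pre_inner_CS D k s t : is_kernel D k -> pts_in D s -> pts_in D t ->
  pre_inner k s t ^+ 2 <= pre_inner k s s * pre_inner k t t.
Proof.
move=> kk Ds Dt; apply: quad_disc => [|c]; first by case: kk => _ /(_ _ Dt).
rewrite -(pre_inner_sq _ kk)//; apply: kk.2.
by apply/pts_in_cat; split => //; apply/pts_in_scale.
Qed.

Lemma pre_sub_sq D k s t : is_kernel D k -> pts_in D s -> pts_in D t ->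
  pre_inner k (pre_sub s t) (pre_sub s t) =
  pre_inner k s s - 2 * pre_inner k s t + pre_inner k t t.
Proof. by move=> kk Ds Dt; rewrite pre_subE (pre_inner_sq _ kk)//; ring. Qed.

Lemma kernel_CS D k x y : is_kernel D k -> D x -> D y -> k x y ^+ 2 <= k x x * k y y.
Proof.
move=> kk Dx Dy.
have := @pre_inner_CS D k [:: (x, 1)] [:: (y, 1)] kk.
rewrite !pre_inner1l !ev_cons !ev_nil /= !mul1r !addr0; exact.
Qed.

Lemma kernel_ge0 D k x : is_kernel D k -> D x -> 0 <= k x x.
Proof.
move=> kk Dx; have := kk.2 [:: (x, 1)].
rewrite pre_inner1l ev_cons ev_nil /= !mul1r addr0; exact.
Qed.

Lemma is_kernelS D D' k : D `<=` D' -> is_kernel D' k -> is_kernel D k.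
Proof.
move=> DD' [ksym kpos]; split=> [x y /DD' ? /DD' ?|s /(pts_inS DD')]; last exact: kpos.
exact: ksym.
Qed.

(** A Schur complement: positivity is Cauchy-Schwarz between [s] and the point mass at [a]. If
    [k a a] is 0, so is its inverse, and nothing is subtracted. *)
Lemma kernel_eliminate D k a : is_kernel D k -> D a ->
  is_kernel D (fun x y => k x y + - (k a a)^-1 * (k a x * k a y)).
Proof.
move=> kk Da; split=> [x y Dx Dy|s Ds].
  by rewrite (kk.1 _ _ Dx Dy) [k a x * _]mulrC.
rewrite pre_innerD pre_innerZ pre_inner_rank1 mulNr subr_ge0 -expr2.
have [->|ka] := eqVneq (k a a) 0; first by rewrite invr0 mul0r; apply: kk.2.
have := @pre_inner_CS D k [:: (a, 1)] s kk.
rewrite !pre_inner1l ev_cons ev_nil /= !mul1r addr0 => CS.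
rewrite mulrC ler_pdivrMr; last by rewrite lt_neqAle eq_sym ka (kernel_ge0 kk).
by rewrite mulrC; apply: CS.
Qed.

(* Schur: eliminating the first point of s from k2 leaves a kernel that
   vanishes there, plus a rank-one term. *)
Lemma kernelM D k1 k2 : is_kernel D k1 -> is_kernel D k2 ->
  is_kernel D (fun x y => k1 x y * k2 x y).
Proof.
move=> kk1 kk2; split=> [x y Dx Dy|s].
  by rewrite (kk1.1 _ _ Dx Dy) (kk2.1 _ _ Dx Dy).
elim: s k2 kk2 => [|[a c] s IH] k2 kk2; first by rewrite pre_innerE ev_nil.
move=> /[dup] Das [/= Da Ds].
set k2' := fun x y => k2 x y + - (k2 a a)^-1 * (k2 a x * k2 a y).
have kk2' : is_kernel D k2' by exact: kernel_eliminate.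
have k2'0 y : D y -> k2' a y = 0.
  have k2'aa : k2' a a = 0.
    rewrite /k2'; have [->|k20] := eqVneq (k2 a a) 0; first by rewrite !mulr0 addr0.
    by rewrite mulNr mulKf// subrr.
  move=> Dy; have := kernel_CS kk2' Da Dy; rewrite k2'aa mul0r => h.
  by apply/eqP; rewrite -sqrf_eq0 eq_le h sqr_ge0.
rewrite (_ : (fun x y => _) = (fun x y => k1 x y * k2' x y +
    (k2 a a)^-1 * (k1 x y * (k2 a x * k2 a y)))); last first.
  by apply/funext => x; apply/funext => y; rewrite /k2'; ring.
rewrite pre_innerD pre_innerZ pre_inner_weight addr_ge0//; last first.
  rewrite mulr_ge0 ?invr_ge0 ?(kernel_ge0 kk2)//.
  by apply: kk1.2; apply/pts_in_weight.
rewrite -cat1s pre_inner_catl !pre_inner_catr.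
have z t : pts_in D t -> pre_inner (fun x y => k1 x y * k2' x y) [:: (a, c)] t = 0.
  move=> Dt; rewrite pre_inner1l (@eq_ev D _ (fun=> 0 * 0)) ?evZ ?mul0r ?mulr0//.
  by move=> y Dy; rewrite k2'0// !mulr0.
rewrite !z// add0r add0r (@pre_innerC D _ s) ?z ?add0r//; first exact: IH.
by move=> x y Dx Dy; rewrite (kk1.1 _ _ Dx Dy) (kk2'.1 _ _ Dx Dy).
Qed.

(** The left form is stable under sums and Schur products; the right form, boundedness of the
    functional [ev f], is what the Riesz argument needs. *)
Lemma pre_inner_rank1_le D k f M :
  psd D (fun x y => M * k x y + - 1 * (f x * f y)) <->
  forall s, pts_in D s -> ev f s ^+ 2 <= M * pre_inner k s s.
Proof.
suff H s : pre_inner (fun x y => M * k x y + - 1 * (f x * f y)) s s =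
    M * pre_inner k s s - ev f s ^+ 2.
  by split=> h s /h; rewrite H subr_ge0.
by rewrite pre_innerD !pre_innerZ pre_inner_rank1; ring.
Qed.

End Combinations.

Section Rkhs.
Context (R : realType) (T : Type).
Implicit Types (f g h : T -> R) (s t : seq (T * R)) (k : T -> T -> R) (D : set T).

Lemma rkhs_rep_ev D k u f s : rkhs_rep D k u f -> pts_in D s ->
  pre_inner k (u n) s @[n --> \oo] --> ev f s.
Proof.
move=> [_ [_ uf]]; elim: s => [_|[x c] s IH [/= Dx Ds]].
  by under eq_cvg do rewrite pre_inner_ev ev_nil; rewrite ev_nil; exact: cvg_cst.
under eq_cvg do rewrite -cat1s pre_inner_catr pre_inner1r.
by rewrite ev_cons; apply: cvgD; [apply: cvgMr; exact: uf|exact: IH].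
Qed.

Lemma rkhs_rep_bounded D k u f : is_kernel D k -> rkhs_rep D k u f ->
  exists2 B, 0 < B & exists N, forall n, (N <= n)%N -> pre_inner k (u n) (u n) <= B.
Proof.
move=> kk [uD [uC _]]; have [N uN] := uC 1 ltr01.
exists (2 + 2 * pre_inner k (u N) (u N)).
  by rewrite ltr_wpDr// mulr_ge0// kk.2.
exists N => n Nn; have := uN n N Nn (leqnn _).
(* Positivity of |u_n - 2 u_N|^2 is equivalent to |u_n|^2 <= 2 |u_n - u_N|^2 + 2 |u_N|^2. *)
have := kk.2 (u n ++ scale (-2) (u N)).
rewrite (pre_sub_sq kk)// (pre_inner_sq _ kk)// => /(_ _)/wrap[|].
  by apply/pts_in_cat; split => //; exact/pts_in_scale.
lra.
Qed.

(* The Riesz representer of the bounded functional ev f is the limit of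
   a minimising sequence of J s = <s, s> - 2 ev f s; the parallelogram identity
   makes it Cauchy, and perturbing it at x shows that it evaluates to f x. *)
Lemma rkhsP D k f : is_kernel D k ->
  rkhs D k f <-> exists M, forall s, pts_in D s -> ev f s ^+ 2 <= M * pre_inner k s s.
Proof.
move=> kk; split=> [[u uf]|[M0 fM0]].
  have [B B0 [N uB]] := rkhs_rep_bounded kk uf.
  exists B => s Ds; have := rkhs_rep_ev uf Ds => cv.
  have cv2 : pre_inner k (u n) s ^+ 2 @[n --> \oo] --> ev f s ^+ 2.
    by under eq_cvg do rewrite expr2; rewrite expr2; apply: cvgM.
  apply: (cvg_seq_le (N := N) cv2) => n Nn.
  apply: le_trans (pre_inner_CS kk (uf.1 n) Ds) _.
  by rewrite ler_wpM2r ?uB// kk.2.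
pose M : R := `|M0|.
have fM s : pts_in D s -> ev f s ^+ 2 <= M * pre_inner k s s.
  move=> Ds; apply: le_trans (fM0 s Ds) _.
  by rewrite ler_wpM2r ?ler_norm// kk.2.
pose J s := pre_inner k s s - 2 * ev f s.
have J_ge s : pts_in D s -> - M <= J s.
  move=> Ds; have := fM s Ds; have := kk.2 s Ds; have : 0 <= M by exact: normr_ge0.
  rewrite /J; move: (pre_inner k s s) (ev f s) => q e m0 q0 em.
  suff : e *+ 2 <= q + M by lra.
  apply: le_trans (ler_norm _) _; apply: norm_le_sq; first exact: addr_ge0.
  have := sqr_ge0 (q - M); lra.
pose A := [set J s | s in [set s | pts_in D s]].
have Ai : has_inf A.
  split; first by exists (J [::]), [::].
  by exists (- M) => _ [s Ds <-]; exact: J_ge.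
pose m := inf A.
have mJ s : pts_in D s -> m <= J s.
  by move=> Ds; apply: ge_inf; [exact: Ai.2|exists s].
have /choice[u uP] (n : nat) : exists s, pts_in D s /\ J s < m + n.+1%:R^-1.
  by have [_ [s Ds <-] Js] := @inf_adherent _ A n.+1%:R^-1 ltac:(by rewrite invr_gt0) Ai; exists s.
have parallelogram s t : pts_in D s -> pts_in D t ->
    pre_inner k (pre_sub s t) (pre_sub s t) <= 2 * (J s - m) + 2 * (J t - m).
  move=> Ds Dt.
  have Dst : pts_in D (s ++ scale 1 t) by apply/pts_in_cat; split => //; exact/pts_in_scale.
  have := mJ (scale 2^-1 (s ++ scale 1 t)) ltac:(exact/pts_in_scale).
  rewrite /J pre_inner_scalel pre_inner_scaler ev_scale ev_cat ev_scale.
  by rewrite (pre_inner_sq _ kk)// (pre_sub_sq kk)//; lra.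
exists u; split; first by move=> n; case: (uP n).
split=> [e e0|x Dx].
  have [N] : exists N : nat, 4 / e < N%:R.
    by exists (Num.truncn (4 / e)).+1; rewrite truncnS_gt.
  rewrite ltr_pdivrMr// => eN; exists N => n1 n2 Nn1 Nn2.
  have [D1 J1] := uP n1; have [D2 J2] := uP n2.
  have small n : (N <= n)%N -> n.+1%:R^-1 < e / 4.
    move=> Nn; rewrite invf_plt ?posrE ?divr_gt0// invf_div ltr_pdivrMr//.
    apply: lt_le_trans eN _; rewrite ler_wpM2r ?(ltW e0)// ler_nat.
    exact: leq_trans Nn (leqnSn _).
  apply: le_lt_trans (parallelogram _ _ D1 D2) _.
  move: (small _ Nn1) (small _ Nn2) J1 J2.
  move: (n1.+1%:R^-1) (n2.+1%:R^-1) (J _) (J _) => a b c d; lra.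
(* Adding c times the point x to [u n] keeps [J] above m. The resulting quadratic in c has constant
   term [J (u n) - m] and linear coefficient twice the error at x, so its discriminant gives the
   bound. *)
have H n : (pre_eval k (u n) x - f x) ^+ 2 <= n.+1%:R^-1 * k x x.
  have [Dn Jn] := uP n.
  have kx0 : 0 <= k x x by exact: kernel_ge0 kk Dx.
  apply: (@le_trans _ _ ((J (u n) - m) * k x x)); last first.
    by rewrite ler_wpM2r// lerBlDl ltW.
  apply: quad_disc => // c.
  have := mJ (u n ++ scale c [:: (x, 1)]).
  rewrite /J (pre_inner_sq _ kk)// ev_cat ev_scale pre_inner1r pre_inner1l.
  rewrite !ev_cons !ev_nil /= => /(_ _)/wrap[|]; last lra.
  by apply/pts_in_cat; split.
apply/cvg_seqP => e e0.
have [N] : exists N : nat, k x x / e ^+ 2 < N%:R.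
  by exists (Num.truncn (k x x / e ^+ 2)).+1; rewrite truncnS_gt.
rewrite ltr_pdivrMr ?exprn_gt0// => eN; exists N => n Nn.
rewrite distrC; apply: norm_lt_sq; first exact: ltW.
apply: le_lt_trans (H n) _; rewrite mulrC ltr_pdivrMr// mulrC.
apply: lt_le_trans eN _; rewrite ler_wpM2r ?sqr_ge0// ler_nat.
exact: leq_trans Nn (leqnSn _).
Qed.

End Rkhs.

Section RkhsOperations.
Context (R : realType) (T : Type).
Implicit Types (f g h : T -> R) (s t : seq (T * R)) (k : T -> T -> R) (D : set T).

Lemma rkhs_lin D k f g a b : is_kernel D k -> rkhs D k f -> rkhs D k g ->
  rkhs D k (fun x => a * f x + b * g x).
Proof.
move=> kk /(rkhsP _ kk)[M fM] /(rkhsP _ kk)[N gN]; apply/(rkhsP _ kk).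
exists (2 * a ^+ 2 * M + 2 * b ^+ 2 * N) => s Ds; rewrite evD !evZ.
have := ler_wpM2l (sqr_ge0 a) (fM s Ds); have := ler_wpM2l (sqr_ge0 b) (gN s Ds).
have := sqr_ge0 (a * ev f s - b * ev g s); nra.
Qed.

Lemma rkhs_section D k x : is_kernel D k -> D x -> rkhs D k (k x).
Proof.
move=> kk Dx; apply/(rkhsP _ kk); exists (k x x) => s Ds.
have := @pre_inner_CS _ _ D k [:: (x, 1)] s kk.
by rewrite !pre_inner1l ev_cons ev_nil /= !mul1r addr0; apply.
Qed.

Lemma rkhs_psd D k f : is_kernel D k -> rkhs D k f ->
  exists2 M, 0 <= M & is_kernel D (fun x y => M * k x y + - 1 * (f x * f y)).
Proof.
move=> kk /(rkhsP _ kk)[M fM]; exists `|M| => //; split.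
  by move=> x y Dx Dy; rewrite (kk.1 _ _ Dx Dy) [f x * _]mulrC.
apply/pre_inner_rank1_le => s Ds; apply: le_trans (fM s Ds) _.
by rewrite ler_wpM2r ?ler_norm// kk.2.
Qed.

(** The functional bound at a difference of two point masses. It passes continuity of the sections
    and of the diagonal of [k] on to the whole RKHS. *)
Lemma rkhs_increment D k f : is_kernel D k -> rkhs D k f ->
  exists2 M, 0 <= M & forall x y, D x -> D y ->
    (f x - f y) ^+ 2 <= M * (k x x - 2 * k x y + k y y).
Proof.
move=> kk /(rkhs_psd kk)[M M0 [_ /pre_inner_rank1_le fM]]; exists M => // x y Dx Dy.
have := fM [:: (x, 1); (y, - 1)] ltac:(by []).
rewrite !pre_innerE !ev_cons !ev_nil /= (kk.1 y x Dy Dx).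
by congr (_ <= _); ring.
Qed.

(** With ff and gg the rank-one kernels of f and g, M N k1 k2 - ff gg = (M k1 - ff) (N k2) + ff (N
    k2 - gg), a sum of two Schur products. *)
Lemma rkhsM D k1 k2 f g : is_kernel D k1 -> is_kernel D k2 ->
  rkhs D k1 f -> rkhs D k2 g -> rkhs D (fun x y => k1 x y * k2 x y) (fun x => f x * g x).
Proof.
move=> kk1 kk2 /(rkhs_psd kk1)[M M0 kf] /(rkhs_psd kk2)[N N0 kg].
have kk := kernelM kk1 kk2; apply/(rkhsP _ kk); exists (M * N).
have Nk2 : is_kernel D (fun x y => N * k2 x y).
  split=> [x y Dx Dy|s Ds]; first by rewrite kk2.1.
  by rewrite pre_innerZ mulr_ge0// kk2.2.
have ff : is_kernel D (fun x y => f x * f y).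
  by split=> [x y _ _|s _]; rewrite ?pre_inner_rank1 -?expr2 ?sqr_ge0// mulrC.
apply/pre_inner_rank1_le => s Ds.
have := (kernelM kf Nk2).2 s Ds; have := (kernelM ff kg).2 s Ds.
move=> /addr_ge0 h /h; rewrite -pre_innerD; congr (_ <= pre_inner _ _ _).
by apply/funext => x; apply/funext => y; ring.
Qed.

Lemma pre_inner_comp (T' : Type) (phi : T' -> T) k (s t : seq (T' * R)) :
  pre_inner (fun x y => k (phi x) (phi y)) s t =
  pre_inner k [seq (phi p.1, p.2) | p <- s] [seq (phi p.1, p.2) | p <- t].
Proof.
by rewrite /pre_inner big_map; apply: eq_bigr => p _; rewrite big_map.
Qed.

Lemma pts_in_comp (T' : Type) (phi : T' -> T) D (D' : set T') (s : seq (T' * R)) :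
  (forall x, D' x -> D (phi x)) -> pts_in D' s ->
  pts_in D [seq (phi p.1, p.2) | p <- s].
Proof. by move=> DD; elim: s => //= p s IH [/DD ? /IH]. Qed.

Lemma kernel_comp (T' : Type) (phi : T' -> T) D (D' : set T') k :
  (forall x, D' x -> D (phi x)) -> is_kernel D k ->
  is_kernel D' (fun x y => k (phi x) (phi y)).
Proof.
move=> DD kk; split=> [x y /DD Dx /DD Dy|s /(pts_in_comp DD) Ds]; first exact: kk.1.
by rewrite pre_inner_comp kk.2.
Qed.

Lemma rkhs_comp (T' : Type) (phi : T' -> T) D (D' : set T') k f :
  (forall x, D' x -> D (phi x)) -> is_kernel D k -> rkhs D k f ->
  rkhs D' (fun x y => k (phi x) (phi y)) (fun x => f (phi x)).
Proof.
move=> DD kk /(rkhsP _ kk)[M fM]; apply/(rkhsP _ (kernel_comp DD kk)).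
exists M => s /(pts_in_comp DD) Ds; rewrite pre_inner_comp.
by have := fM _ Ds; rewrite {1}/ev big_map.
Qed.

End RkhsOperations.

(** * Inner product and distance of the RKHS *)

Section RkhsInner.
Context (R : realType) (T : Type) (D : set T) (k : T -> T -> R)
  (kk : is_kernel D k).
Implicit Types (f g h : T -> R) (s t : seq (T * R)).

(** This is <u_n, g - v_n>: replace g by v_m, apply Cauchy-Schwarz with [u] bounded and [v] Cauchy,
    and let m tend to infinity. *)
Let rkhs_rep_pair u v f g : rkhs_rep D k u f -> rkhs_rep D k v g ->
  ev g (u n) - pre_inner k (u n) (v n) @[n --> \oo] --> (0 : R).
Proof.
move=> uf vg; have [B B0 [N uB]] := rkhs_rep_bounded kk uf.
apply/cvg_seqP => e e0.
have [N' vC] := vg.2.1 (e ^+ 2 / (2 * B)) ltac:(by rewrite divr_gt0 ?exprn_gt0// mulr_gt0).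
exists (maxn N N') => n; rewrite geq_max => /andP[Nn N'n].
have un := uf.1 n; have vn := vg.1.
rewrite sub0r normrN; apply: norm_lt_sq; first exact: ltW.
apply: (@le_lt_trans _ _ (e ^+ 2 / 2)); last by have := exprn_gt0 2 e0; lra.
have cv : (pre_inner k (v m) (u n) - pre_inner k (u n) (v n)) ^+ 2 @[m --> \oo] -->
    (ev g (u n) - pre_inner k (u n) (v n)) ^+ 2.
  under eq_cvg do rewrite expr2.
  by rewrite expr2; apply: cvgM; apply: cvgB (rkhs_rep_ev vg un) (cvg_cst _).
apply: (cvg_seq_le (N := N') cv) => m N'm.
rewrite (pre_innerC kk.1 un (vn n)) -mulN1r -pre_inner_scalel -pre_inner_catl -pre_subE.
apply: le_trans (pre_inner_CS kk _ un) _.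
  by rewrite pre_subE; apply/pts_in_cat; split; [|apply/pts_in_scale].
apply: (@le_trans _ _ (e ^+ 2 / (2 * B) * B)).
  apply: ler_pM; [apply: kk.2| exact: kk.2| |exact: uB].
    by rewrite pre_subE; apply/pts_in_cat; split; [|apply/pts_in_scale].
  by apply: ltW; apply: vC.
by rewrite invfM mulrA mulfVK// gt_eqF.
Qed.

Let rkhs_rep_cvg u f g : rkhs_rep D k u f -> rkhs D k g ->
  cvg (ev g (u n) @[n --> \oo]).
Proof.
move=> uf /(rkhs_psd kk)[M M0 [_ /pre_inner_rank1_le gM]].
apply: cauchy_cvg; apply: cauchy_exP => e e0.
have [N uC] := uf.2.1 (e ^+ 2 / (M + 1)) ltac:(by rewrite divr_gt0 ?exprn_gt0// ltr_wpDl).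
exists (ev g (u N)); exists N => // n /= Nn.
have un := uf.1; have Du : pts_in D (pre_sub (u N) (u n)).
  by rewrite pre_subE; apply/pts_in_cat; split; [|apply/pts_in_scale].
rewrite /ball /=; apply: norm_lt_sq; first exact: ltW.
rewrite -mulN1r -ev_scale -ev_cat -pre_subE.
apply: le_lt_trans (gM _ Du) _; have := uC N n (leqnn _) Nn.
rewrite ltr_pdivlMr ?ltr_wpDl//; have := kk.2 _ Du.
move: (pre_inner _ _ _) => q; lra.
Qed.

(** The definition picks a limit along unknown representing sequences. Trading one sequence at a
    time, by symmetry, shows that every choice has the same limit; convergence for the given [u]
    shows that one exists. *)
Lemma rkhs_inner_cvg u f g : rkhs_rep D k u f -> rkhs D k g ->
  ev g (u n) @[n --> \oo] --> rkhs_inner D k f g.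
Proof.
have pairR u1 v1 f1 g1 (l : R) : rkhs_rep D k u1 f1 -> rkhs_rep D k v1 g1 ->
    pre_inner k (u1 n) (v1 n) @[n --> \oo] --> l -> ev g1 (u1 n) @[n --> \oo] --> l.
  move=> uf vg ul; rewrite -[l]add0r.
  have := cvgD (rkhs_rep_pair uf vg) ul; under eq_cvg do rewrite subrK; exact.
have pairL u1 v1 f1 g1 (l : R) : rkhs_rep D k u1 f1 -> rkhs_rep D k v1 g1 ->
    ev g1 (u1 n) @[n --> \oo] --> l -> pre_inner k (u1 n) (v1 n) @[n --> \oo] --> l.
  move=> uf vg ul; rewrite -[l]subr0.
  have := cvgB ul (rkhs_rep_pair uf vg); under eq_cvg do rewrite subKr; exact.
have sym u1 v1 f1 g1 (l : R) : rkhs_rep D k u1 f1 -> rkhs_rep D k v1 g1 ->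
    ev g1 (u1 n) @[n --> \oo] --> l -> ev f1 (v1 n) @[n --> \oo] --> l.
  move=> uf vg /(pairL _ _ _ _ _ uf vg) h; apply: (pairR _ _ _ _ _ vg uf).
  by under eq_cvg do rewrite (pre_innerC kk.1 (vg.1 _) (uf.1 _)).
move=> uf gH; have [v vg] := gH; have cu := rkhs_rep_cvg uf gH.
rewrite /rkhs_inner; case: xgetP => [r _ [u' [v' [uf' [vg' ur]]]]|/(_ (lim (ev g (u n) @[n --> \oo])))].
  exact: sym vg' uf (sym _ _ _ _ _ uf' vg' (pairR _ _ _ _ _ uf' vg' ur)).
by case; exists u, v; split => //; split => //; apply: pairL uf vg _.
Qed.

Lemma rkhs_inner_pair_cvg u v f g : rkhs_rep D k u f -> rkhs_rep D k v g ->
  pre_inner k (u n) (v n) @[n --> \oo] --> rkhs_inner D k f g.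
Proof.
move=> uf vg; have gH : rkhs D k g by exists v.
rewrite -[rkhs_inner D k f g]subr0.
have := cvgB (rkhs_inner_cvg uf gH) (rkhs_rep_pair uf vg).
under eq_cvg do rewrite subKr; exact.
Qed.

Lemma rkhs_innerC f g : rkhs D k f -> rkhs D k g ->
  rkhs_inner D k f g = rkhs_inner D k g f.
Proof.
move=> [u uf] [v vg]; have h1 := rkhs_inner_pair_cvg uf vg.
apply: (cvg_seq_unique h1).
under eq_cvg do rewrite (pre_innerC kk.1 (uf.1 _) (vg.1 _)).
exact: rkhs_inner_pair_cvg.
Qed.

Lemma rkhs_inner_linr f g h a b : rkhs D k f -> rkhs D k g -> rkhs D k h ->
  rkhs_inner D k f (fun x => a * g x + b * h x) =
  a * rkhs_inner D k f g + b * rkhs_inner D k f h.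
Proof.
move=> [u uf] gH hH; have l1 := rkhs_inner_cvg uf gH; have l2 := rkhs_inner_cvg uf hH.
apply: (cvg_seq_unique (rkhs_inner_cvg uf (rkhs_lin a b kk gH hH))).
under eq_cvg do rewrite evD !evZ.
by apply: cvgD; [exact: cvgMr l1|exact: cvgMr l2].
Qed.

Lemma rkhs_inner_ge0 f : rkhs D k f -> 0 <= rkhs_inner D k f f.
Proof.
move=> [u uf]; have /cvgN/cvg_seq_le := rkhs_inner_pair_cvg uf uf.
move=> /(_ 0 0%N); rewrite oppr_le0; apply => n _.
by rewrite oppr_le0 kk.2//; exact: uf.1.
Qed.

Lemma rkhs0 : rkhs D k (fun=> 0).
Proof.
by apply/(rkhsP _ kk); exists 0 => s _; rewrite ev0 mul0r expr0n.
Qed.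

(** A combination of points of the RKHS collapses to the single function [F s], so its Gram form is
    <F s, F s>. *)
Lemma rkhs_inner_kernel : is_kernel (rkhs D k) (rkhs_inner D k).
Proof.
split=> [f g|s Hs]; first exact: rkhs_innerC.
pose F (s : seq ((T -> R) * R)) (x : T) : R := ev (fun v => v x) s.
have F0 : F [::] = fun=> 0 by apply/funext => x; rewrite /F ev_nil.
have FS v c (w : seq ((T -> R) * R)) : F ((v, c) :: w) = fun x => c * v x + 1 * F w x.
  by apply/funext => x; rewrite /F ev_cons /= mul1r.
have FH (w : seq ((T -> R) * R)) : pts_in (rkhs D k) w -> rkhs D k (F w).
  elim: w => [_|[v c] w IH [/= vH sH]]; first by rewrite F0; exact: rkhs0.
  by rewrite FS; apply: rkhs_lin => //; exact: IH.
have Fr f (w : seq ((T -> R) * R)) : rkhs D k f -> pts_in (rkhs D k) w ->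
    ev (rkhs_inner D k f) w = rkhs_inner D k f (F w).
  move=> fH; elim: w => [_|[v c] w IH [/= vH sH]].
    have z : (fun=> 0) = (fun x => 0 * f x + 0 * f x).
      by apply/funext => x; rewrite !mul0r addr0.
    by rewrite ev_nil F0 z rkhs_inner_linr// !mul0r addr0.
  by rewrite FS rkhs_inner_linr//; [rewrite ev_cons /= mul1r IH|exact: FH].
suff -> : pre_inner (rkhs_inner D k) s s = rkhs_inner D k (F s) (F s).
  by apply: rkhs_inner_ge0; exact: FH.
have FHs := FH _ Hs; rewrite -Fr// pre_innerE.
apply: (eq_ev _ Hs) => v vH; exact: etrans (Fr _ _ vH Hs) (rkhs_innerC vH FHs).
Qed.

Lemma rkhs_inner_CS f g : rkhs D k f -> rkhs D k g ->
  rkhs_inner D k f g ^+ 2 <= rkhs_inner D k f f * rkhs_inner D k g g.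
Proof. exact: kernel_CS rkhs_inner_kernel. Qed.

Lemma rkhsB f g : rkhs D k f -> rkhs D k g -> rkhs D k (fun x => f x - g x).
Proof.
move=> fH gH; have := rkhs_lin 1 (-1) kk fH gH; congr (rkhs _ _ _).
by apply/funext => x; rewrite mul1r mulN1r.
Qed.

Lemma rkhs_innerBr f g h : rkhs D k f -> rkhs D k g -> rkhs D k h ->
  rkhs_inner D k f (fun x => g x - h x) = rkhs_inner D k f g - rkhs_inner D k f h.
Proof.
move=> fH gH hH; have := rkhs_inner_linr 1 (-1) fH gH hH; rewrite mul1r mulN1r => <-.
by congr rkhs_inner; apply/funext => x; rewrite mul1r mulN1r.
Qed.

Lemma rkhs_dist_sq f g : rkhs D k f -> rkhs D k g ->
  rkhs_dist D k f g ^+ 2 =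
  rkhs_inner D k (fun x => f x - g x) (fun x => f x - g x).
Proof.
by move=> fH gH; rewrite /rkhs_dist sqr_sqrtr// rkhs_inner_ge0//; exact: rkhsB.
Qed.

Lemma rkhs_dist_ge0 f g : 0 <= rkhs_dist D k f g.
Proof. exact: sqrtr_ge0. Qed.

Lemma rkhs_inner_dist f g h : rkhs D k f -> rkhs D k g -> rkhs D k h ->
  `|rkhs_inner D k f g - rkhs_inner D k f h| <=
  Num.sqrt (rkhs_inner D k f f) * rkhs_dist D k g h.
Proof.
move=> fH gH hH; have ghH := rkhsB gH hH.
apply: norm_le_sq; first by rewrite mulr_ge0 ?sqrtr_ge0.
rewrite exprMn (rkhs_dist_sq gH hH) (sqr_sqrtr (rkhs_inner_ge0 fH)).
by rewrite -rkhs_innerBr// rkhs_inner_CS.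
Qed.

(** By Cauchy-Schwarz with the point mass at x, |u_m(x) - u_n(x)|^2 <= |u_m - u_n|^2 k(x,x); then m
    tends to infinity. *)
Lemma rkhs_rep_uniform u f B : rkhs_rep D k u f -> (forall x, D x -> k x x <= B) ->
  forall e, 0 < e -> exists N, forall n, (N <= n)%N -> forall x, D x ->
    `|f x - pre_eval k (u n) x| <= e.
Proof.
move=> uf kB e e0; have B1 : 0 < `|B| + 1 by rewrite ltr_wpDl.
have [N uN] := uf.2.1 (e ^+ 2 / (`|B| + 1)) ltac:(by rewrite divr_gt0 ?exprn_gt0).
exists N => n Nn x Dx; have un := uf.1.
have cv : `|pre_eval k (u m) x - pre_eval k (u n) x| @[m --> \oo] -->
    `|f x - pre_eval k (u n) x|.
  by apply: cvg_norm; apply: cvgB; [exact: uf.2.2|exact: cvg_cst].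
apply: (cvg_seq_le (N := N) cv) => m Nm; apply: norm_le_sq; first exact: ltW.
have Dmn : pts_in D (pre_sub (u m) (u n)).
  by rewrite pre_subE; apply/pts_in_cat; split; [|apply/pts_in_scale].
have := @pre_inner_CS _ _ D k (pre_sub (u m) (u n)) [:: (x, 1)] kk Dmn ltac:(by []).
rewrite [pre_inner _ [:: _] _]pre_inner1l ev_cons ev_nil /= !mul1r addr0.
rewrite {1}pre_subE pre_inner_catl pre_inner_scalel !pre_inner1r !mul1r mulN1r.
move=> /le_trans; apply.
have := ltW (uN m n Nm Nn); rewrite ler_pdivlMr// => /(le_trans _); apply.
by rewrite ler_wpM2l ?kk.2// (le_trans (kB x Dx))// (le_trans (ler_norm _))// lerDl.
Qed.

End RkhsInner.

(** * Boundedness of the diagonal of a kernel *)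

Section KernelBounded.
Context (R : realType) (T : Type) (D : set T) (k : T -> T -> R) (kk : is_kernel D k).

(* Gliding hump: if k x x is unbounded, a series of normalised sections with
   suitably chosen signs converges in the RKHS to an unbounded function. *)
Lemma rkhs_kernel_bounded :
  (forall f, rkhs D k f -> exists B, forall x, D x -> `|f x| <= B) ->
  exists B, forall x, D x -> k x x <= B.
Proof.
move=> bd; apply: contrapT => /forallNP unb.
have /choice[x xP] (n : nat) : exists x, D x /\ 4 ^+ n < Num.sqrt (k x x).
  have /existsNP[x /not_implyP[Dx /negP]] := unb ((4 ^+ n) ^+ 2).
  rewrite -ltNge => h; exists x; split => //.
  rewrite -[X in X < _]ger0_norm ?exprn_ge0// -sqrtr_sqr ltr_sqrt//.
  exact: le_lt_trans (sqr_ge0 _) h.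
pose r n : R := Num.sqrt (k (x n) (x n)).
have r0 n : 0 < r n by apply: lt_trans (xP n).2; rewrite exprn_gt0.
have r2 n : r n ^+ 2 = k (x n) (x n) by rewrite sqr_sqrtr// (kernel_ge0 kk (xP n).1).
(* Step n changes the value at [x n] by 3^-n r_n, with the sign of the current value, so that
   nothing cancels. All later steps together change it by at most (3/2) 3^-(n+1) r_n, half of that.
   Since r_n > 4^n, the limit exceeds (4/3)^n / 2 there. *)
pose p : R := 3^-1; have p0 n : 0 < p ^+ n by rewrite exprn_gt0// invr_gt0.
pose sg (s : seq (T * R)) y : R := if 0 <= pre_eval k s y then 1 else - 1.
pose s := fix s n : seq (T * R) := if n is m.+1 then
  s m ++ scale (sg (s m) (x m) * (p ^+ m / r m)) [:: (x m, 1)] else [::].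
have sS n : s n.+1 = s n ++ scale (sg (s n) (x n) * (p ^+ n / r n)) [:: (x n, 1)] by [].
have sD n : pts_in D (s n).
  elim: n => // n IH; apply/pts_in_cat; split => //=.
  by split => //; exact: (xP n).1.
pose nm t := Num.sqrt (pre_inner k t t).
have nm1 n : nm [:: (x n, 1)] = r n.
  by rewrite /nm pre_inner1l ev_cons ev_nil /= !mul1r addr0.
have step n t : pts_in D t ->
    `|pre_inner k (s n.+1) t - pre_inner k (s n) t| <= p ^+ n * nm t.
  move=> Dt; rewrite sS pre_inner_catl addrAC subrr add0r pre_inner_scalel normrM.
  have -> : `|sg (s n) (x n) * (p ^+ n / r n)| = p ^+ n / r n.
    rewrite normrM (gtr0_norm (divr_gt0 _ _))// /sg.
    by case: ifP; rewrite ?normrN normr1 mul1r.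
  rewrite -mulrA ler_wpM2l ?(ltW (p0 n))// mulrC ler_pdivrMr// mulrC.
  apply: norm_le_sq; first by rewrite mulr_ge0 ?sqrtr_ge0 ?(ltW (r0 n)).
  rewrite exprMn r2 sqr_sqrtr; last exact: kk.2.
  have := @pre_inner_CS _ _ D k [:: (x n, 1)] t kk.
  rewrite [pre_inner k [:: _] [:: _]]pre_inner1l ev_cons ev_nil /= !mul1r addr0.
  by apply => //; split => //; exact: (xP n).1.
have tail n m t : pts_in D t ->
    `|pre_inner k (s (n + m)%N) t - pre_inner k (s n) t| <=
    3 / 2 * (p ^+ n - p ^+ (n + m)) * nm t.
  move=> Dt; elim: m => [|m IH]; first by rewrite addn0 !subrr normr0 mulr0 mul0r.
  rewrite addnS -(subrKA (pre_inner k (s (n + m)%N) t)).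
  apply: le_trans (ler_normD _ _) _; apply: le_trans (lerD (step _ _ Dt) IH) _.
  rewrite exprS /p; move: (3^-1 ^+ n) (3^-1 ^+ (n + m)) (nm t) => a b c; lra.
have small c e : 0 < e -> exists N, c * p ^+ N < e.
  move=> e0; have : c * p ^+ n @[n --> \oo] --> c * 0.
    apply: cvgMr; apply: cvg_expr; rewrite ger0_norm ?invr_ge0//.
    by rewrite invf_lt1// ltr1n.
  rewrite mulr0 => /cvg_seqP /(_ e e0)[N /(_ N (leqnn _))].
  by rewrite sub0r normrN => /(le_lt_trans (ler_norm _)); exists N.
have cvgs y : D y -> cvg (pre_eval k (s n) y @[n --> \oo]).
  move=> Dy; apply: cauchy_cvg; apply: cauchy_exP => e e0.
  have [N Ne] := small (3 / 2 * nm [:: (y, 1)]) e e0.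
  exists (pre_eval k (s N) y); exists N => // n /= Nn.
  rewrite /ball /= distrC -(subnKC Nn).
  have := @tail N (n - N)%N [:: (y, 1)] ltac:(by []).
  rewrite !pre_inner1r !mul1r => /le_lt_trans; apply; apply: le_lt_trans Ne.
  rewrite mulrAC ler_wpM2l ?mulr_ge0 ?sqrtr_ge0//.
  by rewrite gerBl ltW.
pose f y := lim (pre_eval k (s n) y @[n --> \oo]).
have fs t : pts_in D t -> pre_inner k (s n) t @[n --> \oo] --> ev f t.
  elim: t => [_|[y c] t IH [/= Dy Dt]].
    by under eq_cvg do rewrite pre_inner_ev ev_nil; rewrite ev_nil; exact: cvg_cst.
  under eq_cvg do rewrite -cat1s pre_inner_catr pre_inner1r.
  by rewrite ev_cons; apply: cvgD; [apply: cvgMr; exact: cvgs|exact: IH].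
have ftail n t : pts_in D t ->
    `|ev f t - pre_inner k (s n) t| <= 3 / 2 * p ^+ n * nm t.
  move=> Dt; have cv : `|pre_inner k (s m) t - pre_inner k (s n) t| @[m --> \oo] -->
      `|ev f t - pre_inner k (s n) t|.
    by apply: cvg_norm; apply: cvgB; [exact: fs|exact: cvg_cst].
  apply: (cvg_seq_le (N := n) cv) => m nm'; rewrite -(subnKC nm').
  apply: le_trans (tail _ _ _ Dt) _; rewrite ler_wpM2r ?sqrtr_ge0//.
  by rewrite ler_wpM2l// gerBl ltW.
have fH : rkhs D k f.
  apply/(rkhsP _ kk); exists ((3 / 2) ^+ 2) => t Dt.
  have := ftail 0%N t Dt; rewrite expr0 mulr1 pre_innerE ev_nil subr0 => h.
  rewrite -[ev f t ^+ 2]real_normK ?num_real// -[pre_inner k t t]sqr_sqrtr ?kk.2//.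
  by rewrite -exprMn ler_sqr ?nnegrE ?mulr_ge0 ?sqrtr_ge0.
have [B fB] := bd f fH.
have low n : p ^+ n * r n <= 2 * `|f (x n)|.
  have h : p ^+ n * r n <= `|pre_eval k (s n.+1) (x n)|.
    have -> : pre_eval k (s n.+1) (x n) = pre_eval k (s n) (x n) +
        sg (s n) (x n) * (p ^+ n * r n).
      have := pre_inner1r k (s n.+1) (x n) 1; rewrite mul1r => <-.
      rewrite sS pre_inner_catl pre_inner_scalel !pre_inner1r [pre_eval k [:: _] _]pre_evalE ev_cons ev_nil /=.
      by rewrite !mul1r addr0 -r2; field; rewrite gt_eqF.
    rewrite /sg; case: ifPn => [h|]; last rewrite -ltNge => h.
      by rewrite mul1r; apply: le_trans (ler_norm _); rewrite lerDr.
    by rewrite mulN1r -normrN opprB; apply: le_trans (ler_norm _); rewrite lerBrDr gerDl ltW.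
  have := ftail n.+1 [:: (x n, 1)] ltac:(by split => //; exact: (xP n).1).
  rewrite nm1 pre_inner1r mul1r exprS.
  have -> : ev f [:: (x n, 1)] = f (x n) by rewrite ev_cons ev_nil /= mul1r addr0.
  have := lerB_dist (pre_eval k (s n.+1) (x n)) (f (x n)); rewrite distrC /p.
  move: h; rewrite /p.
  move: `|pre_eval _ _ _| `|f _| `|_ - _| (3^-1 ^+ n) (r n) => a b c d r1; lra.
have bern n : 1 + n%:R / 3 <= (4 / 3) ^+ n :> R.
  elim: n => [|n IH]; first by rewrite mul0r addr0 expr0.
  rewrite exprS -natr1; have : 0 <= n%:R :> R by []; move: IH; move: (n%:R) (_ ^+ n) => a b; nra.
(* Contradiction in view: 1 + N/3 <= (4/3)^N <= 2 |f (x N)| <= 2 B. *)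
have [N BN] : exists N : nat, 6 * B < N%:R by exists (Num.truncn (6 * B)).+1; rewrite truncnS_gt.
have := bern N; have := low N; have := fB _ (xP N).1; have := (xP N).2.
rewrite -/(r N) => h1 h2 h3 h4.
have : (4 / 3) ^+ N <= p ^+ N * r N.
  by rewrite exprMn mulrC ler_wpM2l ?(ltW (p0 N))// ltW.
lra.
Qed.

End KernelBounded.

(** * The Stone-Weierstrass theorem *)

Section StoneWeierstrass.
Context (R : realType) (T : choiceType).
Implicit Types (f g h : T -> R) (C : set T) (S : set (T -> R)) (cont : set (T -> R)).

Inductive span S : set (T -> R) :=
| span_gen f : S f -> span S f
| span_lin f g a b : span S f -> span S g -> span S (fun x => a * f x + b * g x).

(* Compactness stated through an abstract class of continuous functions, so that
   it covers both d_compact sets and the weak topology on probs X * X, neither of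
   which is a topologicalType. *)
Definition cozero_compact cont C := forall F : T -> T -> R,
  (forall x, C x -> cont (F x) /\ 0 < F x x) ->
  exists s : seq T, (forall x, x \in s -> C x) /\
    forall y, C y -> exists2 x, x \in s & 0 < F x y.

Lemma spanM S f g : (forall f g, S f -> S g -> S (fun x => f x * g x)) ->
  span S f -> span S g -> span S (fun x => f x * g x).
Proof.
move=> SM Sf Sg; elim: Sf => {f} [f Sf|f1 f2 a b _ IH1 _ IH2].
  elim: Sg => {g} [g Sg|g1 g2 a b _ IH1 _ IH2]; first by apply: span_gen; exact: SM.
  rewrite (_ : (fun x => _) = fun x => a * (f x * g1 x) + b * (f x * g2 x)).
    exact: span_lin.
  by apply/funext => x; ring.
rewrite (_ : (fun x => _) = fun x => a * (f1 x * g x) + b * (f2 x * g x)).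
  exact: span_lin.
by apply/funext => x; ring.
Qed.

(* The Newton-type iteration q <- q + (t^2 - q^2)/2 increases to |t|. *)
Fixpoint abs_approx n (t : R) : R :=
  if n is m.+1 then abs_approx m t + 2^-1 * (t ^+ 2 - abs_approx m t ^+ 2) else 0.

(** With a = |t|, a step multiplies the error a - q by 1 - (a + q)/2. In the rate bound this lowers
    2 by a + q, which pays for the additional error term, at most a - q. *)
Lemma abs_approxP n t : `|t| <= 1 ->
  0 <= abs_approx n t <= `|t| /\ n%:R * (`|t| - abs_approx n t) <= 2.
Proof.
move=> t1; have t2 : t ^+ 2 = `|t| ^+ 2 by rewrite real_normK ?num_real.
elim: n => [|n [/andP[q0 qt] nq]] /=; first by rewrite lexx normr_ge0 mul0r.
rewrite t2 -[n.+1%:R]natr1; have : 0 <= n%:R :> R by [].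
move: t1 q0 qt nq (normr_ge0 t); move: (abs_approx n t) `|t| (n%:R) => q a m.
move=> a1 q0 qa mq a0 m0.
have p1 : 0 <= (a - q) * (a + q) by rewrite mulr_ge0 ?subr_ge0 ?addr_ge0.
have p2 : 0 <= (a - q) * (1 - (a + q) / 2) by rewrite mulr_ge0 ?subr_ge0//; lra.
split; first by apply/andP; split; nra.
have -> : a - (q + 2^-1 * (a ^+ 2 - q ^+ 2)) = (a - q) * (1 - (a + q) / 2) by field.
have h1 : m * (a - q) * (1 - (a + q) / 2) <= 2 * (1 - (a + q) / 2) by rewrite ler_wpM2r//; lra.
have h2 : (a - q) * (1 - (a + q) / 2) <= (a - q) * 1 by rewrite ler_wpM2l//; lra.
nra.
Qed.

Context (cont : set (T -> R)) (C : set T) (S : set (T -> R)).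
Context (S1 : S (fun=> 1)) (SM : forall f g, S f -> S g -> S (fun x => f x * g x)).
Context (cont_lin : forall f g a b, cont f -> cont g -> cont (fun x => a * f x + b * g x)).
Context (Scont : S `<=` cont) (Ccomp : cozero_compact cont C).

Let span1 : span S (fun=> 1). Proof. exact: span_gen. Qed.

Let span_cst c : span S (fun=> c).
Proof.
have := span_lin c 0 span1 span1; congr (span S).
by apply/funext => x; rewrite mulr1 mul0r addr0.
Qed.

Let span_cont : span S `<=` cont.
Proof. by move=> f; elim=> {f} [f /Scont//|f g a b _ cf _ cg]; exact: cont_lin. Qed.

Let cont_cst c : cont (fun=> c). Proof. by apply: span_cont. Qed.

Let cont_ub f : cont f -> exists M, forall x, C x -> f x <= M.
Proof.
(* The set of index x is where f < f x + 1; a finite subcover bounds f, with a sum of absolute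
   values in place of a maximum. *)
move=> cf; have [x Cx|s [sC sP]] := Ccomp (F := fun x y => 1 * (f x + 1) + - 1 * f y).
  by split; [exact: cont_lin|rewrite mul1r mulN1r addrAC subrr add0r].
exists (\sum_(x <- s) (`|f x| + 1)) => y /sP[x xs]; rewrite mul1r mulN1r subr_gt0 => /ltW h.
apply: le_trans h _; rewrite (big_rem x)//=; apply: (@le_trans _ _ (`|f x| + 1)).
  by rewrite lerD2r ler_norm.
by rewrite lerDl sumr_ge0.
Qed.

Lemma cozero_compact_bounded f : cont f -> exists2 M, 0 < M & forall x, C x -> `|f x| <= M.
Proof.
move=> cf; have [M fM] := cont_ub cf.
have [N fN] := cont_ub (cont_lin (- 1) 0 cf cf).
exists (`|M| + `|N| + 1) => [|x Cx]; first by rewrite ltr_wpDl.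
have := fM x Cx; have := fN x Cx; rewrite mul0r addr0 mulN1r => h1 h2.
have := ler_norm M; have := ler_norm N; have := normr_ge0 M; have := normr_ge0 N.
by rewrite ler_norml => *; apply/andP; split; lra.
Qed.

Let span_abs f e : span S f -> 0 < e ->
  exists2 h, span S h & forall x, C x -> `| `|f x| - h x| < e.
Proof.
move=> Sf e0; have [M M0 fM] := cozero_compact_bounded (span_cont Sf).
pose n := (Num.truncn (2 * M / e)).+1; have ne : 2 * M / e < n%:R by rewrite truncnS_gt.
have n0 : 0 < n%:R :> R by rewrite ltr0n.
exists (fun x => M * abs_approx n (M^-1 * f x) + 0 * 1) => [|x Cx].
  apply: span_lin => //; elim: n {ne n0} => [|n IH] /=; first exact: span_cst.
  rewrite (_ : (fun x => _) = fun x => 1 * abs_approx n (M^-1 * f x) + 2^-1 *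
     (M^-2 * (f x * f x) + - 1 * (abs_approx n (M^-1 * f x) * abs_approx n (M^-1 * f x)))).
    by do 2 apply: span_lin => //; exact: spanM.
  by apply/funext => x; field; rewrite gt_eqF.
have fx1 : `|M^-1 * f x| <= 1.
  by rewrite normrM gtr0_norm ?invr_gt0// mulrC ler_pdivrMr// mul1r fM.
have [/andP[q0 qf]] := abs_approxP n fx1.
have -> : `|f x| = M * `|M^-1 * f x|.
  by rewrite normrM gtr0_norm ?invr_gt0// mulVKf// gt_eqF.
rewrite mulrC -ler_pdivlMr// mul0r addr0 -mulrBr => h.
rewrite ger0_norm ?mulr_ge0 ?subr_ge0 ?(ltW M0)//.
apply: (@le_lt_trans _ _ (M * (2 / n%:R))); first by rewrite ler_wpM2l// ltW.
by rewrite mulrA ltr_pdivrMr// [M * 2]mulrC [e * _]mulrC -ltr_pdivrMr.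
Qed.

Let span_max f g e : span S f -> span S g -> 0 < e ->
  exists2 h, span S h & forall x, C x -> `|Num.max (f x) (g x) - h x| < e.
Proof.
move=> Sf Sg e0; have [h Sh hP] := span_abs (span_lin 1 (- 1) Sf Sg) e0.
exists (fun x => 2^-1 * (1 * f x + 1 * g x) + 2^-1 * h x) => [|x Cx].
  by do 2 apply: span_lin => //.
have := hP x Cx; rewrite !mul1r mulN1r maxr_absE => hx.
rewrite (_ : _ - _ = 2^-1 * (`|f x - g x| - h x)); last by field.
by rewrite normrM ger0_norm//; have := normr_ge0 (`|f x - g x| - h x); lra.
Qed.

(** The two clauses place [h] within e of the maximum of a finite nonempty family. Half of e serves
    the recursive call, half the binary maximum. *)
Let span_bigmax (F : T -> T -> R) x0 (s : seq T) e : 0 < e ->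
  (forall x, x \in x0 :: s -> span S (F x)) ->
  exists2 h, span S h & forall y, C y ->
    (forall x, x \in x0 :: s -> F x y <= h y + e) /\
    (exists2 x, x \in x0 :: s & h y <= F x y + e).
Proof.
elim: s x0 e => [|x1 s IH] x0 e e0 SF.
  exists (F x0) => [|y Cy]; first by apply: SF; rewrite inE.
  split=> [x|]; first by rewrite inE => /eqP->; rewrite lerDl ltW.
  by exists x0; rewrite ?inE// lerDl ltW.
have e20 : 0 < e / 2 by rewrite divr_gt0.
have [|h Sh hP] := IH x1 (e / 2) e20; first by move=> x xs; apply: SF; rewrite inE xs orbT.
have [m Sm mP] := span_max (SF x0 (mem_head _ _)) Sh e20.
exists m => // y Cy; have [h1 [x xs h2]] := hP y Cy; have := mP y Cy.
rewrite ltr_norml => /andP[m1 m2]; split=> [z|].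
  have := le_max (F x0 y) (F x0 y) (h y); have := le_max (h y) (F x0 y) (h y).
  rewrite !lexx orbT /= => mx1 mx2; rewrite inE => /predU1P[->|/h1 zh]; lra.
case: (leP (F x0 y) (h y)) m1 m2 => _ m1 m2.
  by exists x; [rewrite inE xs orbT|lra].
by exists x0; [rewrite inE eqxx|lra].
Qed.

Let spanN f : span S f -> span S (fun x => - f x).
Proof.
move=> Sf; have := span_lin (- 1) 0 Sf Sf; congr (span S).
by apply/funext => x; rewrite mulN1r mul0r addr0.
Qed.

(** Separation is asked only where [g] takes distinct values, so that points at distance 0, or
    measures with the same integrals of continuous functions, do not have to be identified. *)
Theorem stone_weierstrass g :
  cont g ->
  (forall x y, C x -> C y -> g x = g y \/ exists2 f, S f & f x <> f y) ->
  forall e, 0 < e -> exists2 h, span S h & forall x, C x -> `|g x - h x| < e.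
Proof.
move=> cg gS e e0.
have [[c0 Cc0]|nC] := pselect (exists c, C c); last first.
  by exists (fun=> 1) => // x Cx; case: nC; exists x.
have interp x y : C x -> C y -> exists2 h, span S h & h x = g x /\ h y = g y.
  move=> Cx Cy; have [gxy|[f Sf fxy]] := gS x y Cx Cy.
    by exists (fun=> g x).
  pose a := (g x - g y) / (f x - f y).
  exists (fun z => a * f z + 1 * (g x - a * f x)).
    by apply: span_lin => //; exact: span_gen.
  by split; rewrite /a; field; rewrite subr_eq0; apply/eqP.
have e40 : 0 < e / 4 by rewrite divr_gt0.
have upper x : C x -> exists2 h, span S h &
    h x <= g x + e / 4 /\ forall y, C y -> g y <= h y + e / 2.
  move=> Cx; have /choice[F FP] y : exists h, C y -> [/\ span S h, h x = g x & h y = g y].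
    have [Cy|nCy] := pselect (C y); last by exists (fun=> 0).
    by have [h Sh [h1 h2]] := interp x y Cx Cy; exists h.
  have [y Cy|s [sC sP]] := Ccomp (F := fun y z => 1 * (1 * F y z + - 1 * g z) + 1 * (e / 4)).
    have [Sy _ Fy] := FP y Cy; split; last by rewrite Fy !mul1r mulN1r subrr add0r.
    by do 2 apply: cont_lin => //; exact: span_cont.
  have [|h Sh hP] := @span_bigmax F x s (e / 4) e40.
    move=> y; rewrite inE => /predU1P[->|/sC Cy]; first by have [] := FP x Cx.
    by have [] := FP y Cy.
  exists h => //; split.
    have [_ [y ys hy]] := hP x Cx; apply: le_trans hy _; rewrite lerD2r.
    have Cy : C y by move: ys; rewrite inE => /predU1P[->|/sC].
    by have [_ ->] := FP y Cy.
  move=> y Cy; have [z zs] := sP y Cy; rewrite !mul1r mulN1r => h1.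
  have [h2 _] := hP y Cy; have := h2 z; rewrite inE zs orbT => /(_ isT); lra.
have /choice[H HP] x : exists h, C x -> [/\ span S h, h x <= g x + e / 4 &
    forall y, C y -> g y <= h y + e / 2].
  have [Cx|nCx] := pselect (C x); last by exists (fun=> 0).
  by have [h Sh [h1 h2]] := upper x Cx; exists h.
have [x Cx|s [sC sP]] := Ccomp (F := fun x z => 1 * (1 * g z + - 1 * H x z) + 1 * (e / 2)).
  have [Sx Hx _] := HP x Cx; split; last by rewrite !mul1r mulN1r; lra.
  by do 2 apply: cont_lin => //; exact: span_cont.
(* The minimum of the [H x] is minus the maximum of their opposites. The final error is 3e/4: e/2
   from the one-sided bounds and e/4 from this maximum. *)
have [|h Sh hP] := @span_bigmax (fun x y => - H x y) c0 s (e / 4) e40.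
  move=> y; rewrite inE => /predU1P[->|/sC Cy]; apply: spanN; first by have [] := HP c0 Cc0.
  by have [] := HP y Cy.
exists (fun y => - h y); first exact: spanN.
move=> y Cy; have [h1 [x xs h2]] := hP y Cy; have [z zs] := sP y Cy.
rewrite !mul1r mulN1r => h3; have := h1 z; rewrite inE zs orbT => /(_ isT) h4.
have Cx : C x by move: xs; rewrite inE => /predU1P[->|/sC].
have [_ _ /(_ y Cy) h5] := HP x Cx.
by rewrite ltr_norml; apply/andP; split; lra.
Qed.

End StoneWeierstrass.

(** * Taylor kernels and their normalizations *)

Section MetricContinuity.
Context (R : realType) (T : choiceType) (d : T -> T -> R) (C : set T).
Implicit Types (f g : T -> R).

(** The trace on [C] of the neighbourhoods of x for [d], which makes the general limit theorems
    available for [d_cont_on]. *)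
Definition dnbhs x : set_system T :=
  [set A | exists2 delta, 0 < delta & forall y, C y -> d x y < delta -> A y].

Global Instance dnbhs_filter x : Filter (dnbhs x).
Proof.
split; first by exists 1.
  move=> A B [a a0 aA] [b b0 bB]; exists (Num.min a b); first by rewrite lt_min a0.
  by move=> y Cy; rewrite lt_min => /andP[ya yb]; split; [exact: aA|exact: bB].
by move=> A B AB [a a0 aA]; exists a => // y Cy ya; apply/AB/aA.
Qed.

Lemma d_cont_onP g : d_cont_on d C g <-> forall x, C x -> g @ dnbhs x --> g x.
Proof.
split=> [gc x Cx|gc x Cx e e0].
  by apply/cvgrPdist_lt => e e0; exact: gc.
by have /cvgrPdist_lt/(_ e e0) := gc x Cx.
Qed.

Lemma d_cont_on_lin f g a b : d_cont_on d C f -> d_cont_on d C g ->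
  d_cont_on d C (fun x => a * f x + b * g x).
Proof.
move=> /d_cont_onP cf /d_cont_onP cg; apply/d_cont_onP => x Cx.
by apply: cvgD; apply: cvgMr; [exact: cf|exact: cg].
Qed.

Lemma d_cont_onM f g : d_cont_on d C f -> d_cont_on d C g ->
  d_cont_on d C (fun x => f x * g x).
Proof.
move=> /d_cont_onP cf /d_cont_onP cg; apply/d_cont_onP => x Cx.
by apply: cvgM; [exact: cf|exact: cg].
Qed.

Lemma d_cont_on_cst c : d_cont_on d C (fun=> c).
Proof. by apply/d_cont_onP => x _; exact: cvg_cst. Qed.

Lemma d_cont_on_comp (G : R -> R) g : (forall x, C x -> {for g x, continuous G}) ->
  d_cont_on d C g -> d_cont_on d C (fun x => G (g x)).
Proof.
move=> cG /d_cont_onP cg; apply/d_cont_onP => x Cx.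
exact: (cvg_comp _ _ (cg x Cx) (cG x Cx)).
Qed.

Lemma d_cont_on_dist0 g x y : d_cont_on d C g -> C x -> C y -> d x y <= 0 -> g x = g y.
Proof.
move=> cg Cx Cy dxy; apply/eqP; rewrite -subr_eq0 -normr_le0.
apply/ler_addgt0Pr => e e0; rewrite add0r ltW//.
by have [a a0 ag] := cg x Cx e e0; apply: ag => //; exact: le_lt_trans dxy a0.
Qed.

Lemma d_compact_cozero : d_compact d C -> cozero_compact (d_cont_on d C) C.
Proof.
move=> cC F FP.
have [[c Cc]|nC] := pselect (exists c, C c); last first.
  by exists [::]; split => // y Cy; case: nC; exists y.
pose G := [set U | exists2 x, C x & U = [set y | 0 < F x y]].
have [U [x Cx ->] y Cy /= Fy|y Cy|H HG [fH CH]] := cC G.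
- have [e e0 eP] := (FP x Cx).1 y Cy _ Fy; exists e => // z Cz /(eP z Cz).
  by move/(le_lt_trans (ler_norm _)); rewrite ltrBlDr ltrDl.
- by exists [set z | 0 < F y z]; [exists y|exact: (FP y Cy).2].
have /choice[p pP] (U : set T) : exists x, C x /\ (G U -> U = [set y | 0 < F x y]).
  have [[x Cx Ux]|nG] := pselect (G U); first by exists x.
  by exists c.
have /finite_seqP[s Hs] := fH.
exists [seq p U | U <- s]; split=> [x /mapP[U _ ->]|y /CH[U HU Uy]]; first exact: (pP U).1.
exists (p U); first by apply: map_f; move: HU; rewrite Hs.
by move: Uy; rewrite {1}((pP U).2 (HG _ HU)).
Qed.

(** The increment bound dominates (f x - f y)^2 by a multiple of K x x - 2 K x y + K y y, which is
    continuous in y and vanishes at y = x. *)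
Lemma rkhs_d_cont (K : T -> T -> R) f : is_kernel C K ->
  (forall x, C x -> d_cont_on d C (K x)) -> d_cont_on d C (fun x => K x x) ->
  rkhs C K f -> d_cont_on d C f.
Proof.
move=> kK cK cKd /(rkhs_increment kK)[M M0 fM] x Cx e e0.
have ch := d_cont_on_lin 1 1 (d_cont_on_lin (K x x) (- 2) (d_cont_on_cst 1) (cK x Cx)) cKd.
have M1 : 0 < M + 1 by rewrite ltr_wpDl.
have [a a0 aP] := ch x Cx (e ^+ 2 / (M + 1)) ltac:(by rewrite divr_gt0 ?exprn_gt0).
exists a => // y Cy /(aP y Cy).
rewrite !mul1r !mulr1 (_ : K x x + -2 * K x x + K x x = 0); last by ring.
rewrite sub0r normrN => /(le_lt_trans (ler_norm _)) h.
apply: norm_lt_sq; first exact: ltW.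
apply: le_lt_trans (fM x y Cx Cy) _.
move: h; rewrite ltr_pdivlMr//.
have -> : K x x - 2 * K x y + K y y = K x x + -2 * K x y + K y y by ring.
have : 0 < e ^+ 2 by rewrite exprn_gt0.
move: (K x x + _ + _) (e ^+ 2) => q E; have [q0|q0] := leP 0 q; first lra.
by have := mulr_ge0_le0 M0 (ltW q0); lra.
Qed.

End MetricContinuity.

(** * Sums, powers and limits of kernels *)

Section KernelCombinations.
Context (R : realType) (T : Type).
Implicit Types (f g : T -> R) (k : T -> T -> R) (D : set T).

Lemma eq_kernel D k k' : (forall x y, D x -> D y -> k x y = k' x y) ->
  is_kernel D k -> is_kernel D k'.
Proof.
move=> kk' [ksym kpos]; split=> [x y Dx Dy|s Ds].
  by rewrite -!kk'//; exact: ksym.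
by rewrite -(eq_pre_inner kk' Ds Ds); exact: kpos.
Qed.

Lemma eq_rkhs D k k' f : is_kernel D k -> (forall x y, D x -> D y -> k x y = k' x y) ->
  rkhs D k f -> rkhs D k' f.
Proof.
move=> kk kk' /(rkhsP _ kk)[M fM]; apply/(rkhsP _ (eq_kernel kk' kk)).
by exists M => s Ds; rewrite -(eq_pre_inner kk' Ds Ds); exact: fM.
Qed.

Lemma kernelD D k k' : is_kernel D k -> is_kernel D k' ->
  is_kernel D (fun x y => k x y + k' x y).
Proof.
move=> kk kk'; split=> [x y Dx Dy|s Ds]; first by rewrite kk.1// kk'.1.
by rewrite pre_innerD addr_ge0// ?kk.2// kk'.2.
Qed.

Lemma kernelZ D k c : 0 <= c -> is_kernel D k -> is_kernel D (fun x y => c * k x y).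
Proof.
move=> c0 kk; split=> [x y Dx Dy|s Ds]; first by rewrite kk.1.
by rewrite pre_innerZ mulr_ge0// kk.2.
Qed.

Lemma kernel_rank1 D f : is_kernel D (fun x y => f x * f y).
Proof.
split=> [x y _ _|s _]; first by rewrite mulrC.
by rewrite pre_inner_rank1 -expr2 sqr_ge0.
Qed.

Lemma kernelX D k n : is_kernel D k -> is_kernel D (fun x y => k x y ^+ n).
Proof.
move=> kk; elim: n => [|n IH].
  by apply: eq_kernel (kernel_rank1 D (fun=> 1)) => x y _ _; rewrite expr0 mulr1.
by apply: eq_kernel (kernelM kk IH) => x y _ _; rewrite exprS.
Qed.

Lemma ev_cvg D (F : nat -> T -> R) f s :
  (forall x, D x -> F n x @[n --> \oo] --> f x) -> pts_in D s ->
  ev (F n) s @[n --> \oo] --> ev f s.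
Proof.
move=> Ff; elim: s => [_|[x c] s IH [/= Dx Ds]].
  by under eq_cvg do rewrite ev_nil; rewrite ev_nil; exact: cvg_cst.
under eq_cvg do rewrite ev_cons; rewrite ev_cons.
by apply: cvgD; [apply: cvgMr; exact: Ff|exact: IH].
Qed.

Lemma kernel_lim D (F : nat -> T -> T -> R) k :
  (forall n, is_kernel D (F n)) ->
  (forall x y, D x -> D y -> F n x y @[n --> \oo] --> k x y) -> is_kernel D k.
Proof.
move=> kF Fk; split=> [x y Dx Dy|s Ds].
  apply: (cvg_seq_unique (Fk x y Dx Dy)).
  by under eq_cvg do rewrite (kF _).1//; exact: Fk.
have cv : pre_inner (F n) s s @[n --> \oo] --> pre_inner k s s.
  under eq_cvg do rewrite pre_innerE; rewrite pre_innerE.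
  apply: (ev_cvg (D := D)) => // x Dx; apply: (ev_cvg (D := D)) => // y Dy.
  exact: Fk.
have := cvg_seq_le (N := 0%N) (M := 0) (cvgN cv); rewrite oppr_le0; apply=> n _.
by rewrite oppr_le0 (kF n).2.
Qed.

Lemma power_series_kernel D k (G : R -> R) (c : nat -> R) : is_kernel D k ->
  (forall n, 0 <= c n) ->
  (forall t, (\sum_(0 <= n < N) c n * t ^+ n) @[N --> \oo] --> G t) ->
  is_kernel D (fun x y => G (k x y)).
Proof.
move=> kk c0 cG.
apply: (kernel_lim (F := fun N x y => \sum_(0 <= n < N) c n * k x y ^+ n)) => [N|x y _ _].
  elim: N => [|N IH].
    by apply: eq_kernel (kernel_rank1 D (fun=> 0)) => x y _ _; rewrite big_geq// mulr0.
  apply: eq_kernel (kernelD IH (kernelZ (c0 N) (kernelX N kk))) => x y _ _.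
  by rewrite big_nat_recr.
exact: cG.
Qed.

End KernelCombinations.

(** * Power series with positive coefficients *)

Section PowerSeries.
Context (R : realType) (G : R -> R) (c : nat -> R) (c0 : forall n, 0 < c n)
  (cG : forall t, (\sum_(0 <= n < N) c n * t ^+ n) @[N --> \oo] --> G t).

Let P N t : R := \sum_(0 <= n < N) c n * t ^+ n.

(** Positive coefficients make the series its own majorant: the value at [B] controls the tails
    uniformly on [-B, B]. *)
Let P_tail B N m t : `|t| <= B -> `|P (N + m) t - P N t| <= P (N + m) B - P N B.
Proof.
move=> tB; elim: m => [|m IH]; first by rewrite addn0 !subrr normr0.
rewrite addnS /P !big_nat_recr//= -!/(P _ _) addrAC [_ + _ - P N B]addrAC.
apply: le_trans (ler_normD _ _) _; apply: lerD => //.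
rewrite normrM gtr0_norm// normrX ler_wpM2l ?(ltW (c0 _))//.
by rewrite lerXn2r// ?nnegrE// (le_trans _ tB).
Qed.

Let G_tail B N t : `|t| <= B -> `|G t - P N t| <= G B - P N B.
Proof.
move=> tB; have cv : `|P n t - P N t| - (P n B - P N B) @[n --> \oo] -->
    `|G t - P N t| - (G B - P N B).
  by apply: cvgB; [apply: cvg_norm|]; apply: cvgB; [exact: cG|exact: cvg_cst|exact: cG|exact: cvg_cst].
rewrite -subr_le0; apply: (cvg_seq_le (N := N) cv) => n Nn.
by rewrite subr_le0 -(subnKC Nn) P_tail.
Qed.

Lemma power_series_continuous : continuous G.
Proof.
move=> t; apply/cvgrPdist_lt => e e0; pose B := `|t| + 1.
have e30 : 0 < e / 3 by rewrite divr_gt0.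
have /cvg_seqP/(_ _ e30)[N /(_ N (leqnn _)) NB] := @cG B.
have PN : continuous (P N).
  elim: (N) => [|n IH] x.
    rewrite (_ : P 0 = fun=> 0); first exact: cvg_cst.
    by apply/funext => y; rewrite /P big_geq.
  rewrite (_ : P n.+1 = fun y => P n y + c n * y ^+ n); last first.
    by apply/funext => y; rewrite /P big_nat_recr.
  apply: cvgD; first exact: IH.
  by apply: cvgMr; exact: exprn_continuous.
have /cvgrPdist_lt/(_ _ e30) Pt := PN t.
have tails s : `|s| <= B -> `|G s - P N s| < e / 3.
  move=> sB; apply: le_lt_trans (G_tail N sB) _.
  exact: le_lt_trans (ler_norm _) NB.
near=> s.
have sB : `|s| <= B.
  rewrite -[s](subrK t) addrC; apply: le_trans (ler_normD _ _) _; rewrite lerD2l.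
  by rewrite distrC ltW//; near: s; apply: nbhs_ball_norm.
have tB : `|t| <= B by rewrite lerDl.
have h1 := tails _ sB; have h2 := tails _ tB.
have h3 : `|P N t - P N s| < e / 3 by near: s.
rewrite (_ : G t - G s = (G t - P N t) + (P N t - P N s) - (G s - P N s)); last by ring.
apply: le_lt_trans (ler_normB _ _) _; have := ler_normD (G t - P N t) (P N t - P N s); lra.
Unshelve. all: by end_near. Qed.

(** Keeps the diagonal of the Taylor kernel away from 0, so that normalizing is harmless. *)
Lemma power_series_ge t : 0 <= t -> c 0%N <= G t.
Proof.
move=> t0; rewrite -lerN2; apply: (cvg_seq_le (N := 1%N) (cvgN (@cG t))) => n n1.
rewrite lerN2 big_ltn// expr0 mulr1 lerDl sumr_ge0// => i _.
by rewrite mulr_ge0 ?exprn_ge0// ltW.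
Qed.

(** Without its n-th term the series still has nonnegative coefficients, hence still defines a
    kernel; this is how a single Taylor term is dominated by the whole. *)
Lemma power_series_minus n t :
  (\sum_(0 <= j < N) (if j == n then 0 else c j) * t ^+ j) @[N --> \oo] -->
    G t - c n * t ^+ n.
Proof.
apply/cvg_seqP => e e0.
have /cvg_seqP/(_ e e0)[N NP] := @cG t; exists (maxn N n.+1) => m.
rewrite geq_max => /andP[Nm nm]; rewrite (_ : \sum_(_ <= _ < _) _ = P m t - c n * t ^+ n).
  by rewrite opprB addrA subrK; exact: NP.
apply/eqP; rewrite eq_sym subr_eq; apply/eqP.
have -> : c n * t ^+ n = \sum_(0 <= j < m | j == n) c j * t ^+ j.
  by rewrite big_nat1_eq nm.
rewrite [X in _ + X]big_mkcond -big_split; apply: eq_bigr => j _ /=.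
by case: eqP; rewrite ?mul0r ?add0r ?addr0.
Qed.

End PowerSeries.

(** * Universality of Taylor kernels and of their normalizations *)

Section TaylorKernels.
Context (R : realType) (T : Type) (k : T -> T -> R) (kk : is_kernel setT k)
  (G : R -> R) (c : nat -> R) (c0 : forall n, 0 < c n)
  (cG : forall t, (\sum_(0 <= n < N) c n * t ^+ n) @[N --> \oo] --> G t).

Local Notation H := (rkhs setT k).
Local Notation ip := (rkhs_inner setT k).
Local Notation d := (rkhs_dist setT k).
Let K v w := G (ip v w).

Let ipK : is_kernel H ip := rkhs_inner_kernel kk.

Lemma rkhs_distE v w : H v -> H w -> d v w ^+ 2 = ip v v - 2 * ip v w + ip w w.
Proof.
move=> vH wH; have vwH := rkhsB kk vH wH.
rewrite rkhs_dist_sq// (rkhs_innerBr kk vwH)// (rkhs_innerC kk vwH)// (rkhs_innerC kk vwH)//.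
by rewrite !rkhs_innerBr// (rkhs_innerC kk wH vH); ring.
Qed.

Let K_kernel : is_kernel H K.
Proof. by apply: power_series_kernel ipK _ cG => n; exact: ltW. Qed.

Context (C : set (T -> R)) (CH : C `<=` H).

Lemma rkhs_inner_d_cont w : H w -> d_cont_on d C (ip w).
Proof.
move=> wH v Cv e e0; pose s := Num.sqrt (ip w w).
have s1 : 0 < s + 1 by rewrite ltr_wpDl ?sqrtr_ge0.
exists (e / (s + 1)) => [|u Cu]; first by rewrite divr_gt0.
rewrite ltr_pdivlMr// => h.
apply: le_lt_trans (rkhs_inner_dist kk wH (CH Cv) (CH Cu)) _.
rewrite -/s; apply: le_lt_trans h; rewrite mulrC ler_wpM2l ?lerDl//.
exact: rkhs_dist_ge0.
Qed.

(** From |w|^2 = d(v,w)^2 + 2 <v,w> - |v|^2, whose right side has a known limit as w tends to v. *)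
Lemma rkhs_norm_d_cont : d_cont_on d C (fun v => ip v v).
Proof.
apply/d_cont_onP => v Cv.
have dv : d v w @[w --> dnbhs d C v] --> (0 : R).
  apply/cvgrPdist_lt => e e0; exists e => // w Cw.
  by rewrite sub0r normrN ger0_norm// rkhs_dist_ge0.
have /d_cont_onP/(_ v Cv) iv := rkhs_inner_d_cont (CH Cv).
have cv : d v w * d v w + (2 * ip v w + - ip v v) @[w --> dnbhs d C v] -->
    0 * 0 + (2 * ip v v + - ip v v).
  by apply: cvgD; [exact: cvgM|apply: cvgD; [exact: cvgMr|exact: cvg_cst]].
have -> : ip v v = 0 * 0 + (2 * ip v v + - ip v v) by ring.
apply: cvg_trans cv; apply: near_eq_cvg; exists 1 => // w Cw _.
by rewrite -expr2 rkhs_distE; [ring|exact: CH|exact: CH].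
Qed.

Let K_cont v : C v -> d_cont_on d C (K v).
Proof.
move=> Cv; apply: (d_cont_on_comp (G := G)); last exact: rkhs_inner_d_cont (CH Cv).
by move=> w Cw; exact: (power_series_continuous c0 cG).
Qed.

Let K_diag_cont : d_cont_on d C (fun v => K v v).
Proof.
apply: (d_cont_on_comp (G := G)); last exact: rkhs_norm_d_cont.
by move=> w Cw; exact: (power_series_continuous c0 cG).
Qed.

Inductive monomial : set ((T -> R) -> R) :=
| monomial1 : monomial (fun=> 1)
| monomialS w m : H w -> monomial m -> monomial (fun v => ip w v * m v).

Lemma monomialM m m' : monomial m -> monomial m' -> monomial (fun v => m v * m' v).
Proof.
move=> mm mm'; elim: mm => {m} [|w m wH _ IH].
  by rewrite (_ : (fun v => _) = m')//; apply/funext => v; rewrite mul1r.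
rewrite (_ : (fun v => _) = (fun v => ip w v * (m v * m' v))).
  exact: monomialS.
by apply/funext => v; rewrite mulrA.
Qed.

(** A new factor <w, .> is absorbed by the splitting used for products in the RKHS: (M <v,u>^n -
    m(v) m(u)) |w|^2 <v,u> + m(v) m(u) (|w|^2 <v,u> - <w,v> <w,u>), where the last bracket is a
    kernel by Cauchy-Schwarz. *)
Lemma monomial_dominated m : monomial m -> exists n, exists2 M, 0 <= M &
  is_kernel C (fun v w => M * ip v w ^+ n + - 1 * (m v * m w)).
Proof.
have ipC := is_kernelS CH ipK.
elim=> {m} [|w m wH _ [n [M M0 mM]]].
  exists 0%N, 1 => //; apply: eq_kernel (kernel_rank1 C (fun=> 0)) => v w _ _.
  by rewrite expr0; ring.
have ww0 : 0 <= ip w w by exact: rkhs_inner_ge0.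
exists n.+1, (ip w w * M); first exact: mulr_ge0.
have wK : is_kernel C (fun v u => ip w w * ip v u + - 1 * (ip w v * ip w u)).
  split=> [v u Cv Cu|s Cs].
    by rewrite (ipC.1 v u Cv Cu) (mulrC (ip w v)).
  move: s Cs; apply/pre_inner_rank1_le => s Cs.
  have := @pre_inner_CS _ _ H ip [:: (w, 1)] s ipK.
  rewrite !pre_inner1l ev_cons ev_nil /= !mul1r addr0; apply => //.
  exact: pts_inS CH Cs.
have k1 := kernelM mM (kernelZ ww0 ipC).
have k2 := kernelM (kernel_rank1 C m) wK.
apply: eq_kernel (kernelD k1 k2) => v u _ _; rewrite exprS.
by move: (ip v u) (ip w v) (ip w u) (ip w w) => x y z t; ring.
Qed.

(** With mm the rank-one kernel of m, (M / c_n) K - mm = (M / c_n) (K - c_n <.,.>^n) + (M <.,.>^n -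
    mm). Strict positivity of c_n enters in the division. *)
Let monomial_rkhs m : monomial m -> rkhs C K m.
Proof.
have KC := is_kernelS CH K_kernel.
move=> /monomial_dominated[n [M M0 mM]]; apply/(rkhsP _ KC).
exists (M / c n); apply/pre_inner_rank1_le.
have rest : is_kernel C (fun v w => G (ip v w) - c n * ip v w ^+ n).
  apply: (power_series_kernel (G := fun t => G t - c n * t ^+ n)
    (c := fun j => if j == n then 0 else c j) (is_kernelS CH ipK)) => [j|t].
    by case: ifP => // _; exact: ltW.
  exact: power_series_minus.
have cn0 : c n != 0 by rewrite gt_eqF.
have ker := kernelD (kernelZ (divr_ge0 M0 (ltW (c0 n))) rest) mM.
suff ker' : is_kernel C (fun v w => M / c n * K v w + - 1 * (m v * m w)) by exact: ker'.2.
by apply: eq_kernel ker => v w _ _; rewrite /K; field.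
Qed.

Let monomial_cont m : monomial m -> d_cont_on d C m.
Proof.
elim=> {m} [|w m wH _ IH]; first exact: d_cont_on_cst.
by apply: d_cont_onM => //; exact: rkhs_inner_d_cont.
Qed.

Context (Ccomp : d_compact d C).

Lemma taylor_kernel_universal : universal_wrt (d_cont_on d C) C K.
Proof.
have KC := is_kernelS CH K_kernel.
split=> //; split=> [f|g cg e e0].
  exact: rkhs_d_cont.
have [|||||x y Cx Cy|h hS gh] := stone_weierstrass (S := monomial) (cont := d_cont_on d C)
   (C := C) _ _ _ _ _ cg _ e0.
- exact: monomial1.
- exact: monomialM.
- by move=> f g' a b; exact: d_cont_on_lin.
- exact: monomial_cont.
- exact: d_compact_cozero.
- have [xH yH] := (CH Cx, CH Cy).
  have [dxy|dxy] := leP (d x y) 0; first by left; exact: (d_cont_on_dist0 cg).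
  right; exists (fun v => ip (fun t => x t - y t) v * 1).
    by apply: monomialS monomial1; exact: rkhsB.
  rewrite !mulr1 => /eqP; rewrite -subr_eq0 -rkhs_innerBr//; last exact: rkhsB.
  by rewrite -rkhs_dist_sq// sqrf_eq0 gt_eqF.
exists h => //; elim: hS => {h gh} [h|h1 h2 a b _ IH1 _ IH2]; first exact: monomial_rkhs.
exact: rkhs_lin.
Qed.

Let r v : R := (Num.sqrt (K v v))^-1.

Let K_ge v : H v -> c 0%N <= K v v.
Proof. by move=> vH; apply: (power_series_ge c0 cG); exact: rkhs_inner_ge0. Qed.

Let r_gt0 v : H v -> 0 < r v.
Proof. by move=> /K_ge Kv; rewrite invr_gt0 sqrtr_gt0 (lt_le_trans (c0 0) Kv). Qed.

Let normalizedE v w : H v -> H w ->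
  K v w * (r v * r w) = K v w / Num.sqrt (K v v * K w w).
Proof.
move=> /K_ge Kv _; congr (_ * _); rewrite sqrtrM ?invfM//.
exact: le_trans (ltW (c0 0)) Kv.
Qed.

Lemma normalized_kernel : is_kernel H (fun v w => K v w / Num.sqrt (K v v * K w w)).
Proof. exact: eq_kernel normalizedE (kernelM K_kernel (kernel_rank1 _ r)). Qed.

Let r_cont : d_cont_on d C r.
Proof.
apply: (d_cont_on_comp (G := fun y => (Num.sqrt y)^-1)) K_diag_cont => v Cv.
apply: cvgV; last exact: sqrt_continuous.
by rewrite gt_eqF// sqrtr_gt0 (lt_le_trans (c0 0) (K_ge (CH Cv))).
Qed.

Lemma normalized_kernel_universal : universal_wrt (d_cont_on d C) C
  (fun v w => K v w / Num.sqrt (K v v * K w w)).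
Proof.
have KC := is_kernelS CH K_kernel.
have eC v w : C v -> C w -> K v w * (r v * r w) = K v w / Num.sqrt (K v v * K w w).
  by move=> /CH vH /CH wH; exact: normalizedE.
have nK := is_kernelS CH normalized_kernel.
have nK' := kernelM KC (kernel_rank1 C r).
split=> //; split=> [f fH|g cg e e0].
  apply: (rkhs_d_cont nK' _ _ (eq_rkhs nK (fun v w Cv Cw => esym (eC v w Cv Cw)) fH)).
    move=> v Cv; apply: d_cont_onM (K_cont Cv) _.
    by apply: d_cont_onM r_cont; exact: d_cont_on_cst.
  exact: d_cont_onM K_diag_cont (d_cont_onM r_cont r_cont).
have rC : rkhs C (fun v w => r v * r w) r.
  apply/(rkhsP _ (kernel_rank1 C r)); exists 1 => s _.
  by rewrite pre_inner_rank1 mul1r -expr2.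
(* [rho] bounds the square root of [K v v] from below, so an error below e * rho falls below e after
   multiplication by [r v]. *)
pose rho := Num.sqrt (c 0%N); have rho0 : 0 < rho by rewrite sqrtr_gt0.
have cgr : d_cont_on d C (fun v => g v * Num.sqrt (K v v)).
  apply: d_cont_onM cg (d_cont_on_comp (G := Num.sqrt) _ K_diag_cont).
  by move=> v _; exact: sqrt_continuous.
have [h hK gh] := taylor_kernel_universal.2.2 _ cgr (e * rho) (mulr_gt0 e0 rho0).
exists (fun v => h v * r v); first exact: eq_rkhs nK' eC (rkhsM KC (kernel_rank1 C r) hK rC).
move=> v Cv; have rv := r_gt0 (CH Cv).
have sv : 0 < Num.sqrt (K v v) by rewrite -invr_gt0.
have -> : g v - h v * r v = (g v * Num.sqrt (K v v) - h v) * r v.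
  by rewrite mulrBl /r mulfK// gt_eqF.
rewrite normrM (gtr0_norm rv) /r ltr_pdivrMr//; apply: lt_le_trans (gh v Cv) _.
by rewrite ler_wpM2l ?(ltW e0)// ler_wsqrtr// K_ge//; exact: CH.
Qed.

End TaylorKernels.

(** * Riesz-Markov representation and weak compactness *)

Section ContinuousIntegrals.
Context (R : realType) (X : pseudoPMetricType R) (cX : compact [set: X]).
Implicit Types (f g : X -> R) (P : probs X).

Lemma continuous_bounded f : continuous f -> exists2 M, 0 < M & forall x, `|f x| <= M.
Proof.
move=> cf; have /compact_bounded [M [_ Mf]] : compact (f @` [set: X]).
  by apply: continuous_compact => //; exact: continuous_subspaceT.
exists (`|M| + 1); first by rewrite ltr_wpDl.
by move=> x; apply: Mf; [rewrite (le_lt_trans (ler_norm _))// ltrDl|exists x].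
Qed.

Lemma continuous_measurable f : continuous f ->
  measurable_fun [set: borel_of X] (f : borel_of X -> R).
Proof.
move=> cf; apply: (measurability _ (RGenOpens.measurableE R)).
move=> _ [_ [a [b ->] <-]]; rewrite setTI; apply: sub_sigma_algebra.
by apply: open_comp => [x _|]; [exact: cf|exact: interval_open].
Qed.

Lemma continuous_integrable P f : continuous f -> P.-integrable setT (EFin \o f).
Proof.
move=> cf; apply: measurable_bounded_integrable => //.
- by apply: le_lt_trans (probability_le1 P measurableT) _; rewrite ltry.
- exact: continuous_measurable.
- have [M M0 fM] := continuous_bounded cf.
  exists M; split; first exact: num_real.
  by move=> N MN x _; apply: le_trans (fM x) (ltW MN).
Qed.

Lemma integ_lin P f g a b : continuous f -> continuous g ->
  integ P (fun x => a * f x + b * g x) = a * integ P f + b * integ P g.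
Proof.
move=> cf cg.
have caf : continuous (fun x => a * f x) by move=> x; apply: cvgMr; exact: cf.
have cbg : continuous (fun x => b * g x) by move=> x; apply: cvgMr; exact: cg.
rewrite /integ -[LHS]/(Rintegral P setT (fun x => a * f x + b * g x)).
rewrite RintegralD//; try exact: continuous_integrable.
by congr (_ + _); apply: RintegralZl => //; exact: continuous_integrable.
Qed.

Lemma integ_le P f g : continuous f -> continuous g -> (forall x, f x <= g x) ->
  integ P f <= integ P g.
Proof.
by move=> cf cg fg; apply: le_Rintegral => //; exact: continuous_integrable.
Qed.

Lemma integ_cst P c : integ P (fun=> c) = c.
Proof.
have PT : P setT = 1%E by exact: probability_setT.
transitivity (c * fine (P setT)); first exact: Rintegral_cst.
by rewrite PT mulr1.
Qed.

Lemma integB P f g : continuous f -> continuous g ->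
  integ P (fun x => f x - g x) = integ P f - integ P g.
Proof.
move=> cf cg; have := integ_lin P 1 (-1) cf cg; rewrite mul1r mulN1r => <-.
by congr integ; apply/funext => x; rewrite mul1r mulN1r.
Qed.

Lemma integ_norm P f M : continuous f -> (forall x, `|f x| <= M) -> `|integ P f| <= M.
Proof.
move=> cf fM; rewrite ler_norml -[X in X <= _](integ_cst P) -[X in _ && (_ <= X)](integ_cst P).
by apply/andP; split; apply: integ_le => //; try exact: cst_continuous;
  move=> x; have := fM x; rewrite ler_norml => /andP[].
Qed.

Lemma probability_le_integ P A f : (@measurable _ (borel_of X)) A -> continuous f ->
  (forall x, 0 <= f x) -> (forall x, A x -> 1 <= f x) -> (P A <= (integ P f)%:E)%E.
Proof.
move=> mA cf f0 f1.
have fi := continuous_integrable P cf.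
have -> : (integ P f)%:E = (\int[P]_x (f x)%:E)%E.
  by rewrite /integ fineK//; exact: integrable_fin_num fi.
have <- : (\int[P]_(x in setT) (\1_A x)%:E)%E = P A by rewrite integral_indic// setIT.
apply: ge0_le_integral => //.
- by apply/measurable_EFinP; exact: measurable_indic.
- by apply/measurable_EFinP; exact: continuous_measurable.
- move=> x _; rewrite lee_fin indicE; case: (boolP (x \in A)) => [/set_mem/f1//|_].
  exact: f0.
Qed.

End ContinuousIntegrals.

Section ProbabilityOfMeasure.
Context (R : realType) (d : measure_display) (T : measurableType d)
  (M : {measure set T -> \bar R}) (MT : M setT = 1%E).

Definition probability_of_measure : set T -> \bar R := M.

HB.instance Definition _ := Measure.on probability_of_measure.
HB.instance Definition _ :=
  Measure_isProbability.Build _ _ _ probability_of_measure MT.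

Lemma measure_to_probability : exists P : probability T R, forall A, P A = M A.
Proof. by exists probability_of_measure. Qed.

End ProbabilityOfMeasure.

(** * Construction of the representing measure *)

Section Riesz.
Context (R : realType) (X : pseudoPMetricType R) (cX : compact [set: X])
  (L : (X -> R) -> R)
  (L_lin : forall (f g : X -> R) (a b : R), continuous f -> continuous g ->
     L (fun x => a * f x + b * g x) = a * L f + b * L g)
  (L_le : forall f g : X -> R, continuous f -> continuous g -> (forall x, f x <= g x) ->
     L f <= L g)
  (L_cst : forall c : R, L (fun=> c) = c).
Implicit Types (f g h : X -> R) (U V A B : set X).

(** Only vanishing off [U] is required, not a support inside [U]; the closed sets where f >= e take
    over the role of supports. *)
Let below U f := [/\ continuous f, forall x, 0 <= f x, forall x, f x <= 1
  & forall x, ~ U x -> f x = 0].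

Let lam U := sup [set L f | f in below U].

Let below0 U : below U (fun=> 0).
Proof. by split => // x; exact: cst_continuous. Qed.

Let has_sup_below U : has_sup [set L f | f in below U].
Proof.
split; first by exists (L (fun=> 0)), (fun=> 0).
exists 1 => _ [f [cf _ f1 _] <-]; rewrite -(L_cst 1).
by apply: L_le => // x; exact: cst_continuous.
Qed.

Let le_lam U f : below U f -> L f <= lam U.
Proof. by move=> Uf; apply: ub_le_sup; [exact: (has_sup_below U).2|exists f]. Qed.

Let lam_le U c : (forall f, below U f -> L f <= c) -> lam U <= c.
Proof.
move=> Uc; apply: ge_sup; first exact: (has_sup_below U).1.
by move=> _ [f /Uc ? <-].
Qed.

Let lam_adherent U e : 0 < e -> exists2 f, below U f & lam U - e < L f.
Proof.
by move=> e0; have [_ [f Uf <-] ?] := sup_adherent e0 (has_sup_below U); exists f.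
Qed.

Let lam_ge0 U : 0 <= lam U.
Proof. by rewrite -(L_cst 0); exact: le_lam. Qed.

Let lamS U V : U `<=` V -> lam U <= lam V.
Proof.
move=> UV; apply: lam_le => f [cf f0 f1 fU]; apply: le_lam; split => // x Vx.
by apply: fU => /UV.
Qed.

Let lam0 : lam set0 = 0.
Proof.
apply/eqP; rewrite eq_le lam_ge0 andbT; apply: lam_le => f [cf _ _ f0].
by rewrite (_ : f = fun=> 0) ?L_cst//; apply/funext => x; exact: f0.
Qed.

Let lamT : lam setT = 1.
Proof.
apply/eqP; rewrite eq_le; apply/andP; split.
  apply: lam_le => f [cf _ f1 _]; rewrite -(L_cst 1); apply: L_le => // x.
  exact: cst_continuous.
rewrite -[X in X <= _](L_cst 1); apply: le_lam.
by split => // x; [exact: cst_continuous|move=> /(_ I)].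
Qed.

(** Lowering [f] by e and cutting at 0 makes it vanish wherever it was at most e, at a cost of at
    most e under [L]. *)
Let below_trunc U f e : continuous f -> (forall x, f x <= 1) ->
  0 < e -> (forall x, ~ U x -> f x <= e) ->
  below U (fun x => Num.max (f x - e) 0) /\ L f <= L (fun x => Num.max (f x - e) 0) + e.
Proof.
move=> cf f1 e0 fU.
have cm : continuous (fun x => Num.max (f x - e) 0).
  move=> x; apply: (@continuous_max _ _ (fun x => f x - e) (fun=> 0)).
    by apply: cvgB; [exact: cf|exact: cvg_cst].
  exact: cvg_cst.
split.
  split => // x; first by rewrite le_max lexx orbT.
    by rewrite ge_max ler01 andbT; have := f1 x; lra.
  by move=> Ux; apply/max_idPr; rewrite subr_le0 fU.
have c1 : continuous (fun _ : X => 1 : R) by move=> x; exact: cst_continuous.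
have := L_lin 1 e cm c1; rewrite L_cst mul1r mulr1 => <-.
apply: L_le => //.
  by move=> x; apply: cvgD; [apply: cvgMr; exact: cm|exact: cvg_cst].
by move=> x; rewrite mul1r -lerBlDr le_max lexx.
Qed.

(** Split f as f h + f (1 - h), where the Urysohn function h is 0 off [U] and 1 where f >= e outside
    [V]. The first part is admissible for [U], the second is at most e off [V] and gets
    truncated. *)
Let lamU2 U V : open U -> open V -> lam (U `|` V) <= lam U + lam V.
Proof.
move=> oU oV; apply: lam_le => f [cf f0 f1 fUV]; apply/ler_addgt0Pr => e e0.
pose A := [set x | e <= f x] `&` ~` V.
have cA : closed A.
  apply: closedI; last exact: open_closedC.
  by apply: (@closed_comp _ _ f [set y | e <= y]) => [x _|]; [exact: cf|exact: closed_ge].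
have AU : ~` U `&` A = set0.
  apply/seteqP; split => // x [nU [/= ex nV]]; have := fUV x.
  rewrite /setU /= => /(_ _)/wrap[|fx]; first by case.
  by move: ex; rewrite fx leNgt e0.
have sep := normal_uniform_separator pseudometric_normal (open_closedC oU) cA AU.
pose h : X -> R := Urysohn (~` U) A.
have ch : continuous h by exact: Urysohn_continuous.
have hU x : ~ U x -> h x = 0 by move=> Ux; apply: (Urysohn_sub0 sep); exists x.
have hA x : A x -> h x = 1 by move=> Ax; apply: (Urysohn_sub1 sep); exists x.
have /(_ _) h01 x : `[0, 1]%classic (h x) by apply: Urysohn_range; exists x.
have h0 x : 0 <= h x by have := h01 x; rewrite /= in_itv /= => /andP[].
have h1 x : h x <= 1 by have := h01 x; rewrite /= in_itv /= => /andP[].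
have cfh : continuous (fun x => f x * h x) by move=> x; apply: cvgM; [exact: cf|exact: ch].
have cfh' : continuous (fun x => f x * (1 - h x)).
  by move=> x; apply: cvgM; [exact: cf|apply: cvgB; [exact: cvg_cst|exact: ch]].
have b1 : below U (fun x => f x * h x).
  split => // x; first exact: mulr_ge0.
    by rewrite -[1]mulr1 ler_pM.
  by move=> Ux; rewrite hU// mulr0.
have f1h x : f x * (1 - h x) <= 1.
  by have := f0 x; have := f1 x; have := h0 x; have := h1 x; nra.
have fV x : ~ V x -> f x * (1 - h x) <= e.
  move=> nV; have [ex|ex] := leP e (f x); last by have := f0 x; have := h0 x; nra.
  by rewrite hA// subrr mulr0 ltW.
have [b2 Lb2] := below_trunc cfh' f1h e0 fV.
rewrite (_ : f = fun x => 1 * (f x * h x) + 1 * (f x * (1 - h x))); last first.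
  by apply/funext => x; ring.
rewrite L_lin// !mul1r -addrA; apply: lerD; first exact: le_lam.
by apply: le_trans Lb2 _; rewrite lerD2r; exact: le_lam.
Qed.

Let lam_bigsetU (U : (set X)^nat) n : (forall i, open (U i)) ->
  lam (\big[setU/set0]_(i < n) U i) <= \sum_(i < n) lam (U i).
Proof.
move=> oU; elim: n => [|n IH]; first by rewrite !big_ord0 lam0.
rewrite !big_ord_recr /=; apply: le_trans (lamU2 _ (oU n)) _; last by rewrite lerD2r.
by rewrite -bigcup_mkord; apply: bigcup_open.
Qed.

(** For [f] admissible for the union, the compact set where f >= e lies in finitely many [U i];
    truncation disposes of the rest. *)
Let lam_bigcup (U : (set X)^nat) c : (forall i, open (U i)) ->
  (forall n, \sum_(i < n) lam (U i) <= c) -> lam (\bigcup_i U i) <= c.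
Proof.
move=> oU Uc; apply: lam_le => f [cf f0 f1 fU]; apply/ler_addgt0Pr => e e0.
pose K := [set x | e <= f x].
have cK : compact K.
  apply: (@subclosed_compact _ _ setT) => //.
  by apply: (@closed_comp _ _ f [set y | e <= y]) => [x _|]; [exact: cf|exact: closed_ge].
move: cK; rewrite compact_cover => /(_ nat setT U)[i _|x Kx|D _ KD]; first exact: oU.
  by apply: contrapT => nU; move: Kx; rewrite /K /= (fU x)// leNgt e0.
pose n := (\max_(i <- enum_fset D) i).+1.
have Kn x : K x -> (\big[setU/set0]_(i < n) U i) x.
  move=> /KD [i /= iD Uix]; rewrite -bigcup_mkord; exists i => //=.
  by rewrite /n ltnS (@leq_bigmax_seq _ (enum_fset D) xpredT id i).
have [|b Lb] := @below_trunc (\big[setU/set0]_(i < n) U i) f e cf f1 e0.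
  by move=> x nx; rewrite leNgt; apply/negP => /ltW/Kn.
apply: le_trans Lb _; rewrite lerD2r; apply: le_trans (le_lam b) _.
exact: le_trans (lam_bigsetU _ oU) (Uc n).
Qed.

Let mur A := inf [set lam U | U in [set U | open U /\ A `<=` U]].

Let has_inf_mur A : has_inf [set lam U | U in [set U | open U /\ A `<=` U]].
Proof.
split; first by exists (lam setT), setT => //; split => //; exact: openT.
by exists 0 => _ [U _ <-].
Qed.

Let mur_le A U : open U -> A `<=` U -> mur A <= lam U.
Proof. by move=> oU AU; apply: ge_inf; [exact: (has_inf_mur A).2|exists U]. Qed.

Let le_mur A c : (forall U, open U -> A `<=` U -> c <= lam U) -> c <= mur A.
Proof.
move=> Ac; apply: lb_le_inf; first exact: (has_inf_mur A).1.
by move=> _ [U [oU AU] <-]; exact: Ac.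
Qed.

Let mur_adherent A e : 0 < e -> exists U, [/\ open U, A `<=` U & lam U < mur A + e].
Proof.
move=> e0; have [_ [U [oU AU] <-] ?] := inf_adherent e0 (has_inf_mur A).
by exists U.
Qed.

Let mur_open U : open U -> mur U = lam U.
Proof.
move=> oU; apply/eqP; rewrite eq_le mur_le//=.
by apply: le_mur => V _; exact: lamS.
Qed.

Let mu A := (mur A)%:E.

Let mu0 : mu set0 = 0%E.
Proof. by rewrite /mu mur_open ?lam0//; exact: open0. Qed.

Let mu_ge0 A : (0 <= mu A)%E.
Proof. by rewrite lee_fin; apply: le_mur. Qed.

Let muS : {homo mu : A B / A `<=` B >-> (A <= B)%E}.
Proof.
move=> A B AB; rewrite lee_fin; apply: le_mur => U oU BU.
by apply: mur_le => //; exact: subset_trans AB BU.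
Qed.

Let mu_sigma_subadditive : sigma_subadditive mu.
Proof.
move=> F; apply/lee_addgt0Pr => e e0.
have /choice[U UP] (n : nat) : exists U,
    [/\ open U, F n `<=` U & lam U < mur (F n) + e / (2 ^ n.+1)%:R].
  by apply: mur_adherent; rewrite divr_gt0// ltr0n expn_gt0.
apply: le_trans (epsilon_trick xpredT (fun n => mu_ge0 (F n)) (ltW e0)).
set S := (\sum_(_ <= _ <oo | _) _)%E.
have SU n : ((\sum_(i < n) lam (U i))%:E <= S)%E.
  apply: (@le_trans _ _ (\sum_(0 <= i < n) (mu (F i) + (e / (2 ^ i.+1)%:R)%:E)))%E.
    rewrite big_mkord -sumEFin; apply: lee_sum => i _; rewrite -EFinD lee_fin.
    by have [_ _ /ltW] := UP i.
  apply: nneseries_lim_ge => i _ _; apply: adde_ge0 => //.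
  by rewrite lee_fin divr_ge0// ltW.
case: S SU => [c| |] SU.
- rewrite lee_fin; apply: (@le_trans _ _ (lam (\bigcup_i U i))).
    apply: mur_le; first by apply: bigcup_open => i _; have [] := UP i.
    by apply: subset_bigcup => i _; have [] := UP i.
  by apply: lam_bigcup => [i|n]; [have [] := UP i|rewrite -lee_fin].
- by rewrite leey.
- by have := SU 0%N; rewrite leeNy_eq.
Qed.

(** Take f nearly optimal for V and U together, then g nearly optimal for the part W of V where f <
    e. The truncation of f at e and g are never both nonzero, so their sum is admissible for V. Two
    optimality gaps and one truncation account for e0 / 3. *)
Let open_caratheodory U A : open U -> (mu (A `&` U) + mu (A `&` ~` U) <= mu A)%E.
Proof.
move=> oU; rewrite -EFinD lee_fin; apply: le_mur => V oV AV.
apply/ler_addgt0Pr => e0 e00; pose e := e0 / 3; have e_gt0 : 0 < e by rewrite divr_gt0.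
have [f [cf f0 f1 fUV] Lf] := lam_adherent (V `&` U) e_gt0.
pose W := V `&` [set x | f x < e].
have oW : open W.
  apply: openI => //.
  by apply: (@open_comp _ _ f [set y | y < e]) => [x _|]; [exact: cf|exact: open_lt].
have [g [cg g0 g1 gW] Lg] := lam_adherent W e_gt0.
have m1 : mur (A `&` U) <= lam (V `&` U).
  by apply: mur_le; [exact: openI|exact: setSI].
have m2 : mur (A `&` ~` U) <= lam W.
  apply: mur_le => // x [Ax nU]; split; first exact: AV.
  by rewrite /= fUV// => -[].
have [|[cf' f0' f1' fU'] Lf'] := @below_trunc (V `&` U) f e cf f1 e_gt0.
  by move=> x /fUV ->; exact: ltW.
have fg : below V (fun x => 1 * Num.max (f x - e) 0 + 1 * g x).
  split => [x|x|x|x nV].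
  - by apply: cvgD; apply: cvgMr; [exact: cf'|exact: cg].
  - by rewrite !mul1r addr_ge0.
  - rewrite !mul1r; have [fe|fe] := ltP (f x) e.
      by rewrite (max_idPr _) ?add0r//; lra.
    by rewrite (gW x) ?addr0// => -[_ /=]; rewrite ltNge fe.
  - by rewrite gW ?(fUV x) ?mulr0 ?addr0 ?mul1r// => [|[]|[]]//; rewrite (max_idPr _)//; lra.
have := le_lam fg; rewrite L_lin// !mul1r.
move: (lam _) (lam _) (lam _) (L _) (L _) (L _) (mur _) (mur _) Lf Lg m1 m2 Lf'.
rewrite /e => a b c d p q r s; lra.
Qed.

Lemma riesz_representation : exists P : probs X, forall f, continuous f -> integ P f = L f.
Proof.
pose m : {outer_measure set X -> \bar R} := HB.pack mu
  (isOuterMeasure.Build R X mu mu0 mu_ge0 muS mu_sigma_subadditive).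
have cara : (@measurable _ (borel_of X)) `<=` m.-caratheodory.
  apply: smallest_sub.
    exact: (@sigma_algebra_measurable _ (caratheodory_type m)).
  by move=> U oU; apply: le_caratheodory_measurable => A; exact: open_caratheodory.
have sadd : semi_sigma_additive (mu : set (borel_of X) -> \bar R).
  move=> F mF tF mUF.
  exact: (@caratheodory_measure_sigma_additive R X m F (fun i => cara _ (mF i)) tF (cara _ mUF)).
pose M : {measure set (borel_of X) -> \bar R} := HB.pack (mu : set (borel_of X) -> \bar R)
  (isMeasure.Build _ (borel_of X) R mu mu0 mu_ge0 sadd).
have MT : M setT = 1%E by rewrite /M /= /mu mur_open ?lamT//; exact: openT.
have [P PM] := measure_to_probability MT.
have {PM}PU U : open U -> P U = (lam U)%:E by move=> oU; rewrite PM /M /= /mu mur_open.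
exists P.
suff H f : continuous f -> (forall x, 0 <= f x) -> (forall x, f x <= 1) -> L f <= integ P f.
  move=> f cf; have [M0 M0_gt0 fM] := continuous_bounded cX cf.
  have c1 : continuous (fun _ : X => 1 : R) by move=> x; exact: cst_continuous.
  have affine a b : continuous (fun x => a * f x + b * 1).
    by move=> x; apply: cvgD; [apply: cvgMr; exact: cf|exact: cvg_cst].
  (* Both 1/2 + a f and 1/2 - a f take values in [0, 1]; the one-sided inequality for each yields
     the equality for f. *)
  pose a := (2 * M0)^-1; have a0 : 0 < a by rewrite invr_gt0 mulr_gt0.
  have af x : - 2^-1 <= a * f x <= 2^-1.
    rewrite -ler_norml normrM gtr0_norm//.
    by rewrite /a invfM -mulrA ler_piMr ?invr_ge0// mulrC ler_pdivrMr// mul1r.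
  have h1 := H _ (affine a 2^-1); have h2 := H _ (affine (- a) 2^-1).
  move: h1 h2; rewrite !L_lin// !integ_lin// L_cst integ_cst.
  have [b1 b2 b3 b4] : [/\ forall x, 0 <= a * f x + 2^-1 * 1,
    forall x, a * f x + 2^-1 * 1 <= 1, forall x, 0 <= - a * f x + 2^-1 * 1 &
    forall x, - a * f x + 2^-1 * 1 <= 1] by split=> x; have := af x; lra.
  move=> /(_ b1 b2) h1 /(_ b3 b4) h2.
  by apply/eqP; rewrite -(inj_eq (mulfI (lt0r_neq0 a0))) eq_le; apply/andP; split; lra.
move=> cf f0 f1; apply/ler_addgt0Pr => e e0.
pose N := (Num.truncn e^-1).+1.
have N0 : 0 < N%:R :> R by rewrite ltr0n.
have Ne : N%:R^-1 <= e.
  by rewrite invf_ple ?posrE// ltW// truncnS_gt.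
(* Layer-cake argument: [G j] lies between the indicators of f > (j+1)/N and f > j/N. Hence
   [L (G j.+1)] is at most the measure of f > (j+1)/N, which is at most the integral of [G j].
   Summing the layers, the shift by one index costs only [L (G 0)] <= 1, that is 1/N for f. *)
pose t j x := Num.min (f x) (j%:R / N%:R).
have ct j : continuous (t j).
  by move=> x; apply: (@continuous_min _ _ f (fun=> _)); [exact: cf|exact: cvg_cst].
pose G j x := N%:R * t j.+1 x + - N%:R * t j x.
have cG j : continuous (G j) by move=> x; apply: cvgD; apply: cvgMr; exact: ct.
have step j : j.+1%:R / N%:R = j%:R / N%:R + N%:R^-1 :> R.
  by rewrite -natr1 mulrDl mul1r.
have GE j x : G j x = N%:R * (t j.+1 x - t j x) by rewrite /G mulNr mulrBr.
have NV : 0 < N%:R^-1 :> R by rewrite invr_gt0.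
have G0 j x : 0 <= G j x.
  rewrite GE pmulr_rge0// subr_ge0 /t step.
  rewrite le_min ge_min lexx /= ge_min; apply/orP; right; lra.
have G1 j x : G j x <= 1.
  rewrite GE mulrC -ler_pdivlMr// div1r /t step lerBlDr.
  by have [h|h] := leP (f x) (j%:R / N%:R); rewrite ge_min; apply/orP; [left|right]; lra.
have GN0 j x : ~ (j%:R / N%:R < f x) -> G j x = 0.
  move/negP; rewrite -leNgt => h; rewrite GE /t step !(min_idPl _) ?subrr ?mulr0//; lra.
have GN1 j x : j.+1%:R / N%:R < f x -> G j x = 1.
  move=> h; rewrite GE /t (min_idPr (ltW h)) (min_idPr _); last by move: h; rewrite step; lra.
  by rewrite step addrAC subrr add0r divff// gt_eqF.
have oU j : open [set x | j%:R / N%:R < f x].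
  by apply: (@open_comp _ _ f [set y | _ < y]) => [x _|]; [exact: cf|exact: open_gt].
have bG j : below [set x | j%:R / N%:R < f x] (G j).
  by split => // x; exact: GN0.
have main j : N%:R * L (t j.+1) <= N%:R * integ P (t j) + 1.
  elim: j => [|j IH].
    have t0 : t 0%N = fun=> 0.
      by apply/funext => x; rewrite /t mul0r; apply/min_idPr.
    rewrite t0 integ_cst mulr0 add0r.
    have : L (G 0%N) <= 1.
      rewrite -(L_cst 1); apply: L_le => // x; exact: cst_continuous.
    by rewrite /G L_lin// t0 L_cst mulr0 addr0.
  have : L (G j.+1) <= integ P (G j).
    apply: le_trans (le_lam (bG _)) _; rewrite -lee_fin -PU//.
    apply: probability_le_integ => //; first exact: sub_sigma_algebra.
    by move=> x /= /GN1 ->.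
  by rewrite {1}/G L_lin// /G integ_lin//; lra.
have tN j : (N <= j)%N -> t j = f.
  move=> Nj; apply/funext => x; apply/min_idPl; apply: le_trans (f1 x) _.
  by rewrite ler_pdivlMr// mul1r ler_nat.
have := main N; rewrite !tN// => h.
apply: (@le_trans _ _ (integ P f + N%:R^-1)); last by rewrite lerD2l.
by rewrite -(ler_pM2l N0) mulrDr mulfV// gt_eqF.
Qed.

End Riesz.

(** * Compactness through ultrafilters *)

Section UltrafilterCovers.
Context (T : Type).

(** If no finite subfamily covers, the sets left uncovered generate a proper filter; an ultrafilter
    above it contains [C] and the complement of every [U i] with i in [D]. *)
Lemma ultra_finite_cover (I : choiceType) (C : set T) (D : set I) (U : I -> set T) :
  (forall F : set_system T, UltraFilter F -> F C -> exists2 i, D i & F (U i)) ->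
  exists s : seq I, (forall i, i \in s -> D i) /\
    forall y, C y -> exists2 i, i \in s & U i y.
Proof.
move=> ultraU; apply: contrapT => /forallNP nocover.
pose B (s : seq I) : set T := [set y | C y /\ forall i, i \in s -> ~ U i y].
pose F0 := filter_from [set s : seq I | forall i, i \in s -> D i] B.
have F0p : ProperFilter F0.
  apply: filter_from_proper => [|s sD].
    apply: filter_from_filter; first by exists [::].
    move=> s t sD tD; exists (s ++ t) => [i|y [Cy nU]].
      by rewrite mem_cat => /orP[/sD|/tD].
    by split; split => // i ii; apply: nU; rewrite mem_cat ii ?orbT.
  have /not_andP[//|/existsNP[y /not_implyP[Cy nU]]] := nocover s.
  by exists y; split => // i is_ Ui; apply: nU; exists i.
have [F [FU F0F]] := ultraFilterLemma F0p.
have FC : F C by apply: F0F; exists [::] => // y [].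
have [i Di FUi] := ultraU F FU FC.
have FnU : F (~` U i).
  by apply: F0F; exists [:: i] => [j|y [_]]; [rewrite inE => /eqP->|apply; exact: mem_head].
have : F set0 by rewrite -(setICr (U i)); exact: filterI.
exact: filter_not_empty.
Qed.

Lemma ultra_compact_cvg (Y : topologicalType) (A : set Y) (F : set_system T) (p : T -> Y) :
  UltraFilter F -> compact A -> (forall i, A (p i)) -> exists2 y, A y & p @ F --> y.
Proof.
move=> FU cA pA; have FF : ProperFilter F by exact: ultra_proper.
have FA : (p @ F) A by apply: (@filterE _ F).
have [y [Ay cly]] := cA (p @ F) _ FA.
exists y => // B By.
have [//|nB] := in_ultra_setVsetC (p @^-1` B) FU.
by have [z [nBz Bz]] := cly (~` B) B nB By.
Qed.

End UltrafilterCovers.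

Section WeakTopology.
Context (R : realType) (X : pseudoPMetricType R) (cX : compact [set: X]).
Implicit Types (f : X -> R) (P Q : probs X) (a b : probs X * X).

(** Test functions are merely continuous here; compactness of X restores the boundedness that
    [weak_prod_cont] asks for. *)
Definition wnbhs a : set_system (probs X * X) := [set A |
  exists n (f : 'I_n -> X -> R), exists2 delta, 0 < delta &
    (forall i, continuous (f i)) /\
    forall Q y, (forall i, `|integ Q (f i) - integ a.1 (f i)| < delta) ->
      ball a.2 delta y -> A (Q, y)].

Global Instance wnbhs_filter a : Filter (wnbhs a).
Proof.
split.
- by exists 0%N, (fun _ _ => 0), 1 => //; split => // -[].
- move=> A B [n [f [d d0 [fc fA]]]] [m [g [e e0 [gc gB]]]].
  exists (n + m)%N, (fun i => match fintype.split i with inl j => f j | inr j => g j end).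
  exists (Num.min d e); first by rewrite lt_min d0.
  split=> [i|Q y Qi yb]; first by case: (fintype.split i).
  split.
    apply: fA; last by apply: le_ball yb; rewrite ge_min lexx.
    move=> i; have := Qi (lshift m i).
    by rewrite (unsplitK (inl i)) lt_min => /andP[].
  apply: gB; last by apply: le_ball yb; rewrite ge_min lexx orbT.
  move=> i; have := Qi (rshift n i).
  by rewrite (unsplitK (inr i)) lt_min => /andP[].
- move=> A B AB [n [f [d d0 [fc fA]]]]; exists n, f, d => //; split=> // Q y h1 h2.
  by apply: AB; exact: fA.
Qed.

Lemma weak_prod_contP (g : probs X * X -> R) :
  weak_prod_cont g <-> forall a, g @ wnbhs a --> g a.
Proof.
split=> [gc [P x]|gc P x e e0].
  apply/cvgrPdist_lt => e e0; have [n [f [d d0 [fc fg]]]] := gc P x e e0.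
  exists n, f, d => //; split=> [i|Q y h1 h2]; first exact: (fc i).1.
  by rewrite distrC; exact: fg.
have /cvgrPdist_lt/(_ e e0) [n [f [d d0 [fc fg]]]] := gc (P, x).
exists n, f, d => //; split=> [i|Q y h1 h2]; last by rewrite distrC; exact: fg.
by split => //; have [M M0 fM] := continuous_bounded cX (fc i); exists M.
Qed.

Lemma integ_wcvg f a : continuous f -> integ b.1 f @[b --> wnbhs a] --> integ a.1 f.
Proof.
move=> cf; apply/cvgrPdist_lt => e e0; exists 1%N, (fun=> f), e => //; split=> // Q y h _.
by rewrite distrC; exact: h ord0.
Qed.

Lemma snd_wcvg a : b.2 @[b --> wnbhs a] --> a.2.
Proof.
apply/cvg_ballP => e e0; exists 0%N, (fun _ _ => 0), e => //.
by split => [[]//|Q y _].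
Qed.

Lemma wcvg (I : Type) (F : set_system I) (FF : Filter F) (p : I -> probs X * X) a :
  (forall f, continuous f -> integ (p i).1 f @[i --> F] --> integ a.1 f) ->
  (p i).2 @[i --> F] --> a.2 -> p @ F --> wnbhs a.
Proof.
move=> pf px A [n [f [d d0 [fc fA]]]].
have h1 : \forall i \near F, forall j, `|integ (p i).1 (f j) - integ a.1 (f j)| < d.
  apply: filter_forall => j; have /cvgrPdist_lt/(_ d d0) := pf _ (fc j).
  by apply: filterS => i; rewrite distrC.
have h2 : \forall i \near F, ball a.2 d (p i).2 by have /cvg_ballP/(_ d d0) := px.
suff : F (p @^-1` A) by [].
apply: filterS (filterI h1 h2) => i [q1 q2] /=.
by have := fA _ _ q1 q2; case: (p i).
Qed.

Lemma weak_prod_cont_lin (f g : probs X * X -> R) (u v : R) : weak_prod_cont f ->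
  weak_prod_cont g -> weak_prod_cont (fun a => u * f a + v * g a).
Proof.
move=> /weak_prod_contP fc /weak_prod_contP gc; apply/weak_prod_contP => a.
by apply: cvgD; apply: cvgMr; [exact: fc|exact: gc].
Qed.

Lemma weak_prod_contM (f g : probs X * X -> R) : weak_prod_cont f ->
  weak_prod_cont g -> weak_prod_cont (fun a => f a * g a).
Proof.
move=> /weak_prod_contP fc /weak_prod_contP gc; apply/weak_prod_contP => a.
by apply: cvgM; [exact: fc|exact: gc].
Qed.

Lemma weak_prod_cont_snd f : continuous f -> weak_prod_cont (fun a => f a.2).
Proof.
move=> fc; apply/weak_prod_contP => a; exact: (cvg_comp _ _ (@snd_wcvg a) (fc a.2)).
Qed.

Lemma weak_prod_cont_eq (g : probs X * X -> R) P Q x : weak_prod_cont g ->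
  (forall f, continuous f -> integ P f = integ Q f) -> g (P, x) = g (Q, x).
Proof.
move=> gc PQ; apply/eqP; rewrite eq_sym -subr_eq0 -normr_le0.
apply/ler_addgt0Pr => e e0; rewrite add0r ltW//.
have [n [f [d d0 [fc]]]] := gc P x e e0; apply; last exact: ballxx.
by move=> i; rewrite PQ ?subrr ?normr0//; exact: (fc i).1.
Qed.

(* Riesz-Markov turns the limit of the integrals along an ultrafilter into a
   probability measure: the set of probability measures is weakly compact. *)
Lemma probs_ultra_cvg (I : Type) (F : set_system I) (FU : UltraFilter F) (p : I -> probs X) :
  exists Q, forall f, continuous f -> integ (p i) f @[i --> F] --> integ Q f.
Proof.
pose L f : R := lim (integ (p i) f @[i --> F]).
have cL f : continuous f -> integ (p i) f @[i --> F] --> L f.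
  move=> fc; have [M M0 fM] := continuous_bounded cX fc.
  have [i|l _ il] := ultra_compact_cvg (p := fun i => integ (p i) f) FU (@segment_compact R (- M) M).
    by rewrite /= in_itv /= -ler_norml; exact: integ_norm.
  by apply/cvg_ex; exists l.
have [|||Q QL] := @riesz_representation R X cX L.
- move=> f g a b fc gc; apply: cvg_lim => //.
  under eq_cvg do rewrite integ_lin//.
  by apply: cvgD; apply: cvgMr; exact: cL.
- move=> f g fc gc fg; rewrite -subr_ge0.
  have cgf : integ (p i) g - integ (p i) f @[i --> F] --> L g - L f.
    by apply: cvgB; exact: cL.
  rewrite -(cvg_lim _ cgf)//; apply: limr_ge; first by apply/cvg_ex; exists (L g - L f).
  by apply: filterE => i; rewrite subr_ge0; exact: integ_le.
- move=> c; apply: cvg_lim => //; under eq_cvg do rewrite integ_cst; exact: cvg_cst.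
by exists Q => f fc; rewrite QL//; exact: cL.
Qed.

Lemma weak_prod_cozero_compact : cozero_compact (@weak_prod_cont R X) setT.
Proof.
move=> Fam FamP.
apply: (@ultra_finite_cover _ _ setT setT (fun a => [set b | 0 < Fam a b])) => F FU _.
have [Q FQ] := probs_ultra_cvg FU fst.
have [x _ Fx] := ultra_compact_cvg (p := snd) FU cX (fun=> I).
have Fw : id @ F --> wnbhs (Q, x) by exact: wcvg.
exists (Q, x) => //; have [/weak_prod_contP/(_ (Q, x))/cvgrPdist_lt FamC Fam0] := FamP (Q, x) I.
suff : wnbhs (Q, x) [set b | 0 < Fam (Q, x) b] by exact: Fw.
apply: filterS (FamC _ Fam0) => b.
by move=> /(le_lt_trans (ler_norm _)); rewrite ltrBlDr ltrDl.
Qed.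

End WeakTopology.

(** * Kernel mean embeddings *)

Section MeanEmbedding.
Context (R : realType) (X : pseudoPMetricType R) (cX : compact [set: X])
  (k' : X -> X -> R) (k'_cont : continuous (fun p : X * X => k' p.1 p.2))
  (k'_univ : universal_wrt (fun f : X -> R => continuous f) setT k').
Implicit Types (f : X -> R) (P Q : probs X) (a b : probs X * X).

Local Notation H := (rkhs setT k').
Local Notation ip := (rkhs_inner setT k').
Local Notation d := (rkhs_dist setT k').
Local Notation Psi := (kme k').

Let kk : is_kernel setT k' := k'_univ.1.

Let k'_contl t : continuous (k'^~ t).
Proof.
move=> x; have xt : (y, t) @[y --> x] --> (x, t) by apply: cvg_pair; [exact: cvg_id|exact: cvg_cst].
exact: (cvg_comp _ _ xt (@k'_cont (x, t))).
Qed.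

Let k'_diag_bounded : exists2 B, 0 < B & forall x, k' x x <= B.
Proof.
have [|B B0 kB] := @continuous_bounded R X cX (fun x => k' x x); last first.
  by exists B => // x; exact: le_trans (ler_norm _) (kB x).
move=> x; have xx : (y, y) @[y --> x] --> (x, x) by apply: cvg_pair; exact: cvg_id.
exact: (cvg_comp _ _ xx (@k'_cont (x, x))).
Qed.

Let ev_k'_cont s : continuous (fun x => ev (k' x) s).
Proof.
elim: s => [|[t c] s IH].
  rewrite (_ : (fun x => _) = fun=> 0); first by move=> x; exact: cvg_cst.
  by apply/funext => x; rewrite ev_nil.
rewrite (_ : (fun x => _) = fun x => c * k' x t + ev (k' x) s).
  by move=> x; apply: cvgD; [apply: cvgMr; exact: k'_contl|exact: IH].
by apply/funext => x; rewrite ev_cons.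
Qed.

Let ev_kme P s : ev (Psi P) s = integ P (fun x => ev (k' x) s).
Proof.
elim: s => [|[t c] s IH].
  by rewrite ev_nil (_ : (fun x => _) = fun=> 0) ?integ_cst//; apply/funext => x; rewrite ev_nil.
rewrite ev_cons IH /= /kme -[X in _ + X]mul1r -integ_lin//.
by congr integ; apply/funext => x; rewrite ev_cons mul1r.
Qed.

(** Evaluating [s] on [Psi P] integrates x |-> <k'(x,.), s>, which is bounded by the square root of
    B |s|^2 by Cauchy-Schwarz. *)
Lemma kme_rkhs P : H (Psi P).
Proof.
have [B B0 kB] := k'_diag_bounded; apply/(rkhsP _ kk); exists B => s Ds.
rewrite ev_kme; set q := pre_inner k' s s; have q0 : 0 <= q by exact: kk.2.
rewrite -[B * q]sqr_sqrtr ?mulr_ge0 ?(ltW B0)// -[integ _ _ ^+ 2]real_normK ?num_real//.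
rewrite ler_sqr ?nnegrE ?sqrtr_ge0//; apply: integ_norm => // x.
apply: norm_le_sq; first exact: sqrtr_ge0.
rewrite sqr_sqrtr ?mulr_ge0 ?(ltW B0)//.
apply: (@le_trans _ _ (k' x x * q)); last by rewrite ler_wpM2r.
have := @pre_inner_CS _ _ setT k' [:: (x, 1)] s kk.
by rewrite !pre_inner1l ev_cons ev_nil /= !mul1r addr0; apply.
Qed.

(** A sequence representing [h] converges uniformly because the diagonal of [k'] is bounded, so its
    integrals converge as well. *)
Lemma rkhs_inner_kme P h : H h -> ip h (Psi P) = integ P h.
Proof.
move=> hH; have [u uh] := hH; have ch := k'_univ.2.1 _ hH.
apply: (cvg_seq_unique (rkhs_inner_cvg kk uh (kme_rkhs P))).
have [B B0 kB] := k'_diag_bounded.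
apply/cvg_seqP => e e0; have e20 : 0 < e / 2 by rewrite divr_gt0.
have [N uN] := rkhs_rep_uniform kk uh (fun x _ => kB x) e20.
exists N => n Nn; rewrite ev_kme -(integB cX P ch (@ev_k'_cont (u n))).
apply: (@le_lt_trans _ _ (e / 2)); last by lra.
apply: integ_norm => //.
  by move=> x; apply: cvgB; [exact: ch|exact: ev_k'_cont].
move=> x; have := uN n Nn x I; rewrite pre_evalE.
by congr (`|_ - _| <= _); apply: (@eq_ev _ _ setT) (pts_inT _) => y _; exact: kk.1.
Qed.

(** Compactness in x turns joint continuity into sup-norm continuity of t |-> k'(., t); compactness
    in t then gives a finite net. *)
Let k'_net e : 0 < e -> exists s : seq X,
  forall t, exists2 z, z \in s & forall x, `|k' x t - k' x z| < e.
Proof.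
move=> e0; pose U z := [set t | forall x, `|k' x t - k' x z| < e].
have Unbhs z : nbhs z (U z).
  suff : \forall t \near z, [set: X] `<=` (fun x => `|k' x t - k' x z| < e).
    by apply: filterS => t + x; exact.
  apply: ((compact_near_coveringP [set: X]).1 cX) => x _.
  have e20 : 0 < e / 2 by rewrite divr_gt0.
  have /cvgrPdist_lt/(_ _ e20) := @k'_cont (x, z).
  case=> -[V W] /= [Vx Wz] VW; exists (V, W) => // -[x' t] /= [Vx' Wt].
  have h1 := VW (x', t) (conj Vx' Wt); have h2 := VW (x', z) (conj Vx' (nbhs_singleton Wz)).
  move: h1 h2; rewrite /= !ltr_norml => /andP[? ?] /andP[? ?]; apply/andP; split; lra.
move: cX; rewrite compact_cover => /(_ X setT (fun z => (U z)°)) [z _|t _|D _ DU].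
- exact: open_interior.
- by exists t => //; exact: Unbhs.
exists (enum_fset D) => t; have [z /= zD Ut] := DU t I.
by exists z => //; exact: interior_subset Ut.
Qed.

(* Weak convergence implies convergence of the mean embeddings: the squared
   distance is the integral of Psi P - Psi Q against P - Q, and the sections of k'
   are equicontinuous. *)
Lemma kme_cvg (I : Type) (F : set_system I) (FF : Filter F) (p : I -> probs X) Q :
  (forall f, continuous f -> integ (p i) f @[i --> F] --> integ Q f) ->
  forall e, 0 < e -> \forall i \near F, d (Psi Q) (Psi (p i)) < e.
Proof.
(* The embeddings will differ by at most 3 e' uniformly, hence the squared distance is at most 6 e',
   below e^2. *)
move=> pQ e e0; pose e' := e ^+ 2 / 8; have e'0 : 0 < e' by rewrite divr_gt0 ?exprn_gt0.
have [s sP] := k'_net e'0.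
have : \forall i \near F, forall z, z \in s ->
    `|integ Q (k'^~ z) - integ (p i) (k'^~ z)| < e'.
  elim: s {sP} => [|z s IH]; first by apply: filterE.
  have /cvgrPdist_lt/(_ _ e'0) h := pQ _ (@k'_contl z).
  by apply: filterS (filterI h IH) => i [h1 h2] y; rewrite inE => /predU1P[->|/h2].
apply: filterS => i si.
have small t : `|Psi Q t - Psi (p i) t| <= 3 * e'.
  have [z zs zt] := sP t.
  have near P : `|Psi P t - Psi P z| <= e'.
    rewrite /kme -integB//; apply: integ_norm => //.
      by move=> x; apply: cvgB; exact: k'_contl.
    by move=> x; exact: ltW.
  have := near Q; have := near (p i); have := si z zs; rewrite -!/(kme _ _ _).
  move: (Psi _ t) (Psi _ t) (Psi _ z) (Psi _ z) => u v w y.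
  by rewrite ltr_norml !ler_norml => /andP[h1 h2] /andP[h3 h4] /andP[h5 h6]; apply/andP; split; lra.
have QH := kme_rkhs Q; have pH := kme_rkhs (p i).
have dH := rkhsB kk QH pH; have cd := k'_univ.2.1 _ dH.
have int_small P : `|integ P (fun x => Psi Q x - Psi (p i) x)| <= 3 * e'.
  exact: integ_norm.
rewrite -ltr_sqr ?nnegrE ?(ltW e0) ?rkhs_dist_ge0// rkhs_dist_sq//.
rewrite rkhs_innerBr// !rkhs_inner_kme//.
have := int_small Q; have := int_small (p i); rewrite !ler_norml => /andP[h1 h2] /andP[h3 h4].
have : 0 < e ^+ 2 by rewrite exprn_gt0.
by move: h1 h2 h3 h4; rewrite /e'; lra.
Qed.

(** For h in the RKHS the integrals differ by <h, Psi P - Psi Q>, at most |h| times the distance;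
    [f] is within e/3 of such an h. *)
Lemma kme_reflect_weak P f e : continuous f -> 0 < e ->
  exists2 delta, 0 < delta & forall Q, d (Psi P) (Psi Q) < delta ->
    `|integ P f - integ Q f| < e.
Proof.
move=> cf e0; have e30 : 0 < e / 3 by rewrite divr_gt0.
have [h hH fh] := k'_univ.2.2 f cf _ e30; have ch := k'_univ.2.1 _ hH.
pose s := Num.sqrt (ip h h); have s1 : 0 < s + 1 by rewrite ltr_wpDl ?sqrtr_ge0.
exists (e / 3 / (s + 1)) => [|Q]; first by rewrite divr_gt0.
rewrite ltr_pdivlMr// => dPQ.
have h1 : `|integ P h - integ Q h| < e / 3.
  rewrite -!rkhs_inner_kme//.
  apply: le_lt_trans (rkhs_inner_dist kk hH (kme_rkhs P) (kme_rkhs Q)) _.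
  apply: le_lt_trans dPQ; rewrite mulrC ler_wpM2l ?lerDl//; exact: rkhs_dist_ge0.
have approx P' : `|integ P' f - integ P' h| <= e / 3.
  rewrite -integB//; apply: integ_norm => //.
    by move=> x; apply: cvgB; [exact: cf|exact: ch].
  by move=> x; exact: ltW (fh x I).
have := approx P; have := approx Q; move: h1.
by rewrite !ltr_norml !ler_norml => /andP[? ?] /andP[? ?] /andP[? ?]; apply/andP; split; lra.
Qed.

(** The cover is pulled back to measures, where every ultrafilter converges weakly, hence also in
    the distance of the embeddings. *)
Lemma kme_compact : d_compact d (range Psi).
Proof.
move=> G Gopen Gcover.
have [|s [sG sC]] := @ultra_finite_cover (probs X) (set (X -> R)) setT G
    (fun V => [set P | V (Psi P)]).
  move=> F FU _; have FF : ProperFilter F by exact: ultra_proper.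
  have [Q FQ] := probs_ultra_cvg cX FU id.
  have [V GV VQ] := Gcover (Psi Q) (ex_intro2 _ _ Q I erefl); exists V => //.
  have [e e0 eV] := Gopen V GV (Psi Q) (ex_intro2 _ _ Q I erefl) VQ.
  apply: filterS (kme_cvg (p := id) _ FQ e0) => P dP.
  by apply: eV => //; exists P.
exists [set` s]; first by move=> V /sG.
split; first exact: finite_seq.
by move=> _ [P _ <-]; have [V Vs VP] := sC P I; exists V.
Qed.

End MeanEmbedding.

(** * Universality of the product kernel *)

Section ProductKernel.
Context (R : realType) (X : pseudoPMetricType R) (hX : hausdorff_space X)
  (cX : compact [set: X])
  (k' : X -> X -> R) (k'_cont : continuous (fun p : X * X => k' p.1 p.2))
  (k'_univ : universal_wrt (fun f : X -> R => continuous f) setT k')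
  (kX : X -> X -> R) (K : (X -> R) -> (X -> R) -> R)
  (kX_univ : universal_wrt (fun f : X -> R => continuous f) setT kX)
  (K_univ : K_assumption k' K).
Implicit Types (f : X -> R) (P Q : probs X) (a b : probs X * X).

Local Notation H := (rkhs setT k').
Local Notation d := (rkhs_dist setT k').
Local Notation Psi := (kme k').
Let C := range Psi.
Let kbar a b := K (Psi a.1) (Psi b.1) * kX a.2 b.2.

Let PsiC P : C (Psi P). Proof. by exists P. Qed.

Let CH : C `<=` H. Proof. by move=> _ [P _ <-]; exact: kme_rkhs. Qed.

Let C_univ : universal_wrt (d_cont_on d C) C K.
Proof. by apply: K_univ.2 => //; exact: kme_compact. Qed.

Let KP_kernel : is_kernel setT (fun a b => K (Psi a.1) (Psi b.1)).
Proof. by apply: (kernel_comp (D := C) (phi := fun a => Psi a.1)) C_univ.1. Qed.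

Let KX_kernel : is_kernel setT (fun a b => kX a.2 b.2).
Proof. by apply: (kernel_comp (D := setT) (phi := snd)) kX_univ.1. Qed.

Let kbar_kernel : is_kernel setT kbar.
Proof. exact: kernelM. Qed.

Let d_cont_comp (h : (X -> R) -> R) : d_cont_on d C h -> weak_prod_cont (fun a => h (Psi a.1)).
Proof.
move=> hc; apply/(weak_prod_contP cX) => a; apply/cvgrPdist_lt => e e0.
have [delta delta0 hd] := hc _ (PsiC a.1) e e0.
have := @kme_cvg R X cX k' k'_cont k'_univ _ _ (wnbhs_filter a) fst a.1
  (fun f fc => integ_wcvg fc) delta delta0.
by apply: filterS => b; exact: hd.
Qed.

Let kbar_section_cont a : weak_prod_cont (kbar a).
Proof.
apply: (weak_prod_contM cX).
  apply: (d_cont_comp (h := K (Psi a.1))); apply: C_univ.2.1.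
  exact: rkhs_section C_univ.1 (PsiC _).
apply: (weak_prod_cont_snd cX); apply: kX_univ.2.1.
exact: rkhs_section kX_univ.1 _.
Qed.

Let kbar_bounded : exists B, forall a, kbar a a <= B.
Proof.
have [B1 KB] : exists B, forall v, C v -> K v v <= B.
  apply: rkhs_kernel_bounded C_univ.1 _ => f /C_univ.2.1 fc.
  have [|||M M0 fM] := @cozero_compact_bounded R _ (d_cont_on d C) C
    [set (fun=> 1)] erefl _ _ _ f fc.
  - by move=> g h a b; exact: d_cont_on_lin.
  - by move=> _ ->; exact: d_cont_on_cst.
  - by apply: d_compact_cozero; exact: kme_compact.
  by exists M.
have [B2 kB] : exists B, forall x, setT x -> kX x x <= B.
  apply: rkhs_kernel_bounded kX_univ.1 _ => f /kX_univ.2.1 fc.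
  by have [M M0 fM] := continuous_bounded cX fc; exists M.
exists (B1 * B2) => a; apply: ler_pM; last exact: kB.
- exact: kernel_ge0 C_univ.1 (PsiC _).
- exact: kernel_ge0 kX_univ.1 _.
- exact: KB (PsiC _).
Qed.

Let pre_eval_cont s : weak_prod_cont (pre_eval kbar s).
Proof.
elim: s => [|[a c] s IH].
  rewrite (_ : pre_eval _ _ = fun=> 0).
    by apply/(weak_prod_contP cX) => a; exact: cvg_cst.
  by apply/funext => b; rewrite pre_evalE ev_nil.
rewrite (_ : pre_eval _ _ = fun b => c * kbar a b + 1 * pre_eval kbar s b).
  exact: (weak_prod_cont_lin cX).
by apply/funext => b; rewrite !pre_evalE ev_cons mul1r.
Qed.

Let rkhs_kbar_cont (f : probs X * X -> R) : rkhs setT kbar f -> weak_prod_cont f.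
Proof.
move=> [u uf]; have [B kB] := kbar_bounded.
apply/(weak_prod_contP cX) => a; apply/cvgrPdist_lt => e e0.
have e40 : 0 < e / 4 by rewrite divr_gt0.
have [N /(_ N (leqnn _)) uN] := rkhs_rep_uniform kbar_kernel uf (fun a _ => kB a) e40.
have /(weak_prod_contP cX)/(_ a)/cvgrPdist_lt/(_ _ e40) := pre_eval_cont (u N).
apply: filterS => b; have := uN a I; have := uN b I.
by rewrite !ltr_norml !ler_norml => /andP[? ?] /andP[? ?] /andP[? ?]; apply/andP; split; lra.
Qed.

Let tensor : set (probs X * X -> R) := [set f | exists (g : probs X -> R) (h : X -> R),
  [/\ weak_prod_cont (fun a => g a.1), continuous h & f = fun a => g a.1 * h a.2]].

Let approx (f : probs X * X -> R) := forall e, 0 < e ->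
  exists2 h, rkhs setT kbar h & forall a, `|f a - h a| < e.

Let approx_lin (f g : probs X * X -> R) (u v : R) : approx f -> approx g -> approx (fun a => u * f a + v * g a).
Proof.
move=> af ag e e0.
have u0 : 0 < 2 * (`|u| + 1) by rewrite mulr_gt0// ltr_wpDl.
have v0 : 0 < 2 * (`|v| + 1) by rewrite mulr_gt0// ltr_wpDl.
have [h hH fh] := af _ (divr_gt0 e0 u0); have [h' hH' gh] := ag _ (divr_gt0 e0 v0).
exists (fun a => u * h a + v * h' a) => [|a]; first exact: rkhs_lin.
rewrite (_ : _ - _ = u * (f a - h a) + v * (g a - h' a)); last by ring.
apply: le_lt_trans (ler_normD _ _) _; rewrite !normrM [e]splitr.
have half (w z : R) : 0 < 2 * (`|w| + 1) -> `|z| < e / (2 * (`|w| + 1)) -> `|w| * `|z| < e / 2.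
  move=> w0; rewrite ltr_pdivlMr// => h1.
  by have := normr_ge0 w; have := normr_ge0 z; nra.
by apply: ltrD; apply: half.
Qed.

(* A weakly continuous function of P factors through Psi, since d-convergence of
   mean embeddings forces weak convergence. *)
Let factor (g : probs X -> R) : weak_prod_cont (fun a => g a.1) ->
  exists2 h, d_cont_on d C h & forall P, h (Psi P) = g P.
Proof.
(* [x0] fills the second coordinate, weak continuity being stated on the product; its Dirac mass
   serves as the value of [p] off [C]. [p] selects one preimage under Psi, so [g] is then shown to
   be constant on the fibres. *)
move=> gc; pose x0 : X := point.
have d0 : probs X := @dirac _ (borel_of X) x0 R.
have /choice[p pP] v : exists P, C v -> Psi P = v.
  by have [[P _ <-]|nCv] := pselect (C v); [exists P|exists d0].
have weak P Q : d (Psi P) (Psi Q) <= 0 -> g P = g Q.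
  move=> dPQ; apply: (weak_prod_cont_eq (g := fun a => g a.1) x0 gc) => f fc.
  apply/eqP; rewrite -subr_eq0 -normr_le0; apply/ler_addgt0Pr => e e0.
  have [delta delta0 h] := kme_reflect_weak cX k'_cont k'_univ P fc e0.
  by rewrite add0r ltW// h// (le_lt_trans dPQ).
exists (fun v => g (p v)) => [|P]; last first.
  apply: weak; rewrite (pP _ (PsiC P)) le_eqVlt -sqrf_eq0.
  have PH := CH (PsiC P); rewrite (rkhs_distE k'_univ.1 PH PH).
  by apply/orP; left; apply/eqP; ring.
apply/d_cont_onP => v Cv.
have pw : (p w, x0) @[w --> dnbhs d C v] --> wnbhs (p v, x0).
  apply: wcvg; last exact: cvg_cst.
  move=> f fc; apply/cvgrPdist_lt => e e0.
  have [delta delta0 h] := kme_reflect_weak cX k'_cont k'_univ (p v) fc e0.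
  by exists delta => // w Cw; rewrite -{1}(pP v Cv) -{1}(pP w Cw); exact: h.
have /(weak_prod_contP cX)/(_ (p v, x0)) gv := gc.
exact: (cvg_comp _ _ pw gv).
Qed.

Let tensor_approx (f : probs X * X -> R) : tensor f -> approx f.
Proof.
move=> [g [h [gc hc ->]]] e e0.
have [g' g'c g'g] := factor gc.
have [Mh Mh0 hM] := continuous_bounded cX hc.
have [|||Mg Mg0 gM] := @cozero_compact_bounded R _ (d_cont_on d C) C
    [set (fun=> 1)] erefl _ _ _ g' g'c.
- by move=> *; exact: d_cont_on_lin.
- by move=> _ ->; exact: d_cont_on_cst.
- by apply: d_compact_cozero; exact: kme_compact.
(* Tuned to p r - q s = (p - q) r + q (r - s), each term at most e/2. The minimum with 1 gives |q| <
   Mg + 1, whence [e2]. *)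
pose e1 := Num.min 1 (e / (2 * Mh)); have e10 : 0 < e1.
  by rewrite lt_min ltr01 divr_gt0// mulr_gt0.
pose e2 := e / (2 * (Mg + 1)); have e20 : 0 < e2.
  by rewrite divr_gt0// mulr_gt0// addr_gt0.
have [u uH gu] := C_univ.2.2 g' g'c e1 e10.
have [w wH hw] := kX_univ.2.2 h hc e2 e20.
exists (fun a => u (Psi a.1) * w a.2).
  apply: rkhsM KP_kernel KX_kernel _ _.
    by apply: (rkhs_comp (D := C) (phi := fun a => Psi a.1)) => //; exact: C_univ.1.
  by apply: (rkhs_comp (D := setT) (phi := snd)) => //; exact: kX_univ.1.
move=> a; rewrite -g'g.
have h1 := gu _ (PsiC a.1); have h2 := hw a.2 I; have h3 := hM a.2; have h4 := gM _ (PsiC a.1).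
move: h1 h2 h3 h4; move: (g' _) (u _) (h _) (w _) => p q r s h1 h2 h3 h4.
have q1 : `|q| < Mg + 1.
  rewrite -[q](subrK p) addrC; apply: le_lt_trans (ler_normD _ _) _.
  by apply: ler_ltD => //; rewrite distrC; apply: lt_le_trans h1 _; rewrite ge_min lexx.
rewrite (_ : _ - _ = (p - q) * r + q * (r - s)); last by ring.
apply: le_lt_trans (ler_normD _ _) _; rewrite !normrM [e]splitr.
apply: ler_ltD.
  apply: (@le_trans _ _ (e / (2 * Mh) * Mh)).
    by apply: ler_pM => //; apply: ltW; apply: lt_le_trans h1 _; rewrite ge_min lexx orbT.
  by rewrite invfM mulrA mulfVK// gt_eqF.
apply: (@le_lt_trans _ _ ((Mg + 1) * `|r - s|)); first by rewrite ler_wpM2r// ltW.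
rewrite mulrC -ltr_pdivlMr ?addr_gt0//.
by apply: lt_le_trans h2 _; rewrite /e2 invfM mulrA.
Qed.

Lemma product_kernel_universal : universal_wrt (@weak_prod_cont R X) setT kbar.
Proof.
split; first exact: kbar_kernel.
split; first exact: rkhs_kbar_cont.
move=> g gc e e0; have e20 : 0 < e / 2 by rewrite divr_gt0.
have tensor1 : tensor (fun=> 1).
  exists (fun=> 1), (fun=> 1); split; last by apply/funext => a; rewrite mulr1.
    by apply/(weak_prod_contP cX) => a; exact: cvg_cst.
  by move=> x; exact: cvg_cst.
have [|||||h hS gh] := stone_weierstrass (S := tensor) (cont := @weak_prod_cont R X)
   (C := setT) tensor1 _ _ _ _ gc _ e20.
- move=> _ _ [g1 [h1 [gc1 hc1 ->]]] [g2 [h2 [gc2 hc2 ->]]].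
  exists (fun P => g1 P * g2 P), (fun x => h1 x * h2 x); split.
  + exact: (weak_prod_contM cX).
  + by move=> x; apply: cvgM; [exact: hc1|exact: hc2].
  + by apply/funext => a; ring.
- by move=> *; exact: (weak_prod_cont_lin cX).
- move=> _ [g1 [h1 [gc1 hc1 ->]]]; apply: (weak_prod_contM cX) => //.
  exact: (weak_prod_cont_snd cX).
- exact: weak_prod_cozero_compact.
(* Distinct integrals of some f separate the pairs. Otherwise [g] does not see the difference
   between P and Q, and distinct points x, y are separated by a Urysohn function. *)
- move=> [P x] [Q y] _ _.
  have [PQ|/existsNP[f /not_implyP[fc fPQ]]] :=
      pselect (forall f, continuous f -> integ P f = integ Q f); last first.
    right; exists (fun a => integ a.1 f * 1); last by rewrite !mulr1.
    exists (fun P => integ P f), (fun=> 1); split => //.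
      by apply/(weak_prod_contP cX) => a; exact: integ_wcvg.
    by move=> z; exact: cvg_cst.
  have [<-|xy] := eqVneq x y; first by left; exact: weak_prod_cont_eq.
  right.
  have cy : closed [set y] by apply: accessible_closed_set1; exact: hausdorff_accessible.
  have nxy : ~ [set y] x by move=> /= xy'; rewrite xy' eqxx in xy.
  have sep : uniform_separator [set x] [set y] by exact: point_uniform_separator.
  have := (@uniform_separatorP X R [set x] [set y]).1 sep.
  move=> [f [fc _ fx fy]].
  exists (fun a => 1 * f a.2).
    exists (fun=> 1), f; split => //.
    by apply/(weak_prod_contP cX) => a; exact: cvg_cst.
  rewrite !mul1r /= (fx (f x)); last by exists x.
  rewrite (fy (f y)); last by exists y.
  by apply/eqP; rewrite eq_sym oner_eq0.
have {}hS : approx h.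
  elim: hS => {h gh} [h|h1 h2 a b _ IH1 _ IH2]; first exact: tensor_approx.
  exact: approx_lin.
have [h' h'H hh'] := hS _ e20; exists h' => // a _.
rewrite -(subrKA (h a)) [e]splitr; apply: le_lt_trans (ler_normD _ _) _.
by apply: ltrD; [exact: gh|exact: hh'].
Qed.

End ProductKernel.

Theorem theorem5p3 (R : realType) (X : pseudoPMetricType R)
  (hX : hausdorff_space X) (cX : compact [set: X])
  (k' : X -> X -> R)
  (k'_cont : continuous (fun p : X * X => k' p.1 p.2))
  (k'_univ : universal_wrt (fun f : X -> R => continuous f) setT k') :
  (* main claim *)
  (forall (kX : X -> X -> R) (K : (X -> R) -> (X -> R) -> R),
     universal_wrt (fun f : X -> R => continuous f) setT kX ->
     K_assumption k' K ->
     universal_wrt (@weak_prod_cont R X) setT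
       (fun a b : probs X * X =>
          K (kme k' a.1) (kme k' b.1) * kX a.2 b.2)) /\
  (* sufficient condition 1: K(v,v') = G(<v,v'>), G entire with positive
     Taylor coefficients *)
  (forall (G : R -> R) (c : nat -> R),
     (forall n, 0 < c n) ->
     (forall t, (\sum_(0 <= n < N) c n * t ^+ n) @[N --> \oo] --> G t) ->
     K_assumption k' (fun v v' => G (rkhs_inner setT k' v v'))) /\
  (* sufficient condition 2: the normalized version of such a kernel *)
  (forall (G : R -> R) (c : nat -> R),
     (forall n, 0 < c n) ->
     (forall t, (\sum_(0 <= n < N) c n * t ^+ n) @[N --> \oo] --> G t) ->
     let K0 := fun v v' => G (rkhs_inner setT k' v v') in
     K_assumption k' (fun v v' => K0 v v' / Num.sqrt (K0 v v * K0 v' v'))).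
Proof.
split; first by move=> kX K kX_univ K_univ; exact: product_kernel_universal.
have kk := k'_univ.1.
split=> [G c c0 cG|G c c0 cG K0]; split.
- by apply: power_series_kernel (rkhs_inner_kernel kk) _ cG => n; exact: ltW.
- by move=> C CH cC; exact: (taylor_kernel_universal kk c0 cG CH cC).
- exact: (normalized_kernel kk c0 cG).
- by move=> C CH cC; exact: (normalized_kernel_universal kk c0 cG CH cC).
Qed.
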